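(* We have $$\tilde{\mathcal{L}}_2=\pi_2(\mathcal{M}^{\mathrm{abs}}_{\le_{\mathrm{lex}}})\cap\big[0,\tfrac12\big]\neq\pi_2(\mathcal{M}^{\mathrm{abs}}_{\le_{\mathrm{lex}}}),\qquad \tilde{\mathcal{L}}_3=\pi_3(\mathcal{M}^{\mathrm{abs}}_{\le_{\mathrm{lex}}}),$$ $$\pi_q(\mathcal{M}^{\mathrm{abs}}_{\le_{\mathrm{lex}}})=\tilde{\mathcal{L}}_q\cap\big[0,\tfrac{1}{q-1}\big]\neq\tilde{\mathcal{L}}_q\quad\text{for all integers } q\ge4.$$ For all integers $q\ge2$, we have $\tilde{\mathbf{m}}_q=\pi_q(\mathbf{m}^{\mathrm{abs}}_{\le_{\mathrm{lex}}})=\pi_q(\varrho_2(\mathbf{m}_{\le_{\mathrm{alt}}}))$ and $$\tilde{\mathcal{L}}_q\cap[0,\tilde{\mathbf{m}}_q)=\pi_q(\mathcal{M}^{\mathrm{abs}}_{\le_{\mathrm{lex}}})\cap[0,\tilde{\mathbf{m}}_q)=\{0\}\cup\{\pi_q(\varrho_2(\tau_{0,2}^n(0^\infty))) : n\ge0\}.$$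
   Context: For real $q>1$, $\tilde{\mathcal{L}}_q=\{\limsup_{n\to\infty}\|xq^n\| : x\in\mathbb{R}\}$, where $\|\cdot\|$ is the distance to the nearest integer, and $\tilde{\mathbf{m}}_q\in\mathbb{R}$ denotes the smallest accumulation point of $\tilde{\mathcal{L}}_q$. For a word $a_1a_2\cdots$ with integer digits, $\pi_q(a_1a_2\cdots)=\sum_{n=1}^\infty a_nq^{-n}$. For a finite alphabet $A$, $A^\infty$ (one-sided infinite words) carries the ultrametric $d(a_1a_2\cdots,b_1b_2\cdots)=2^{-\min\{n\ge1 : a_n\ne b_n\}}$ for distinct words (and $d(\mathbf{a},\mathbf{a})=0$). On $\{0,\pm1\}^\infty$ let $\le_{\mathrm{lex}}$ be the lexicographic order with $-1<0<1$. Let $-\mathbf{a}=(-a_1)(-a_2)\cdots$ and $\mathrm{abs}(\mathbf{a})=\mathbf{a}$ if $\mathbf{a}\ge_{\mathrm{lex}}0^\infty$, $\mathrm{abs}(\mathbf{a})=-\mathbf{a}$ if $\mathbf{a}\le_{\mathrm{lex}}0^\infty$. Let $s^{\mathrm{abs}}_{\le_{\mathrm{lex}}}(a_1a_2\cdots)=\sup_{n\ge1}\mathrm{abs}(a_na_{n+1}\cdots)$ (w.r.t. $\le_{\mathrm{lex}}$), $\mathcal{M}^{\mathrm{abs}}_{\le_{\mathrm{lex}}}=\{s^{\mathrm{abs}}_{\le_{\mathrm{lex}}}(\mathbf{a}):\mathbf{a}\in\{0,\pm1\}^\infty\}$, and let $\mathbf{m}^{\mathrm{abs}}_{\le_{\mathrm{lex}}}$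 be the smallest (w.r.t. $\le_{\mathrm{lex}}$) accumulation point (w.r.t. $d$) of $\mathcal{M}^{\mathrm{abs}}_{\le_{\mathrm{lex}}}$. On $\{0,1\}^\infty$ let $\le_{\mathrm{alt}}$ be the alternating lexicographic order: for distinct $\mathbf{a},\mathbf{b}$ with longest common prefix $w$, followed by letters $a\ne b$ in $\mathbf{a}$ and $\mathbf{b}$ respectively, $\mathbf{a}<_{\mathrm{alt}}\mathbf{b}$ if and only if ($a<b$ and the length $|w|$ is even) or ($a>b$ and $|w|$ is odd). $\mathbf{m}_{\le_{\mathrm{alt}}}$ is the smallest (w.r.t. $\le_{\mathrm{alt}}$) accumulation point (w.r.t. $d$) of $\mathcal{M}_{\le_{\mathrm{alt}}}=\{\sup_{n\ge1}a_na_{n+1}\cdots : a_1a_2\cdots\in\{0,1\}^\infty\}$ (suprema w.r.t. $\le_{\mathrm{alt}}$). $\tau_{0,2}$ is the word morphism $0\mapsto1$, $1\mapsto100$, and $\tau_{0,2}^n$ is its $n$-th iterate. The map $\varrho_2:\{0,1\}^*\to\{0,\pm1\}^*$ sends the empty word to the empty word and satisfies, for $w\in\{0,1\}^*$: $\varrho_2(w0)=\varrho_2(w)\,1$ and $\varrho_2(w1)=\varrho_2(w)\,1\,0$ if $|w|$ is even; $\varrho_2(w0)=\varrho_2(w)\,(-1)$ and $\varrho_2(w1)=\varrho_2(w)\,(-1)\,0$ if $|w|$ is odd. These maps are extended naturally to infinite words. *)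

(* Defs.v *)
From HB Require Import structures.
From mathcomp Require Import all_boot all_order all_algebra.
From mathcomp Require Import all_classical all_reals all_analysis.

Set Implicit Arguments.
Unset Strict Implicit.
Unset Printing Implicit Defensive.

Import Order.TTheory GRing.Theory Num.Theory.
Import numFieldNormedType.Exports.

Local Open Scope classical_set_scope.
Local Open Scope ring_scope.

(* An infinite word a_1 a_2 ... is a sequence indexed from 0: the letter
   a_(n+1) is [a n].  A finite alphabet A is a list of integers and A^oo is the
   set [words A]. *)
Definition word : Type := nat -> int.

Definition words (A : seq int) : set word := [set a | forall n, a n \in A].

Definition bin : seq int := [:: 0; 1].
Definition tern : seq int := [:: -1; 0; 1].

Definition zerow : word := fun=> 0.
Definition oppw (a : word) : word := fun n => - a n.
Definition shift (n : nat) (a : word) : word := fun k => a (n + k)%N.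

(* With k the least 0-based index at which a and b differ, the least 1-based
   index is k.+1. *)
Definition word_dist (R : realType) (a b : word) : R :=
  if pselect (exists n, a n != b n) is left ab then 2 ^- (ex_minn ab).+1
  else 0.

Definition le_lex (a b : word) : Prop :=
  a = b \/
  exists n, (forall k, (k < n)%N -> a k = b k) /\ a n < b n.

Definition le_alt (a b : word) : Prop :=
  a = b \/
  exists n, (forall k, (k < n)%N -> a k = b k) /\
    ((~~ odd n /\ a n < b n) \/ (odd n /\ b n < a n)).

Definition absw (a : word) : word :=
  if `[< le_lex zerow a >] then a else oppw a.

Definition is_sup (T : Type) (D : set T) (le : T -> T -> Prop) (S : set T)
    (s : T) : Prop :=
  [/\ D s, forall t, S t -> le t s &
      forall u, D u -> (forall t, S t -> le t u) -> le s u].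

Definition is_smallest (T : Type) (le : T -> T -> Prop) (S : set T) (m : T) :
    Prop :=
  S m /\ forall t, S t -> le m t.

Definition word_accumulation (R : realType) (A : seq int) (M : set word) :
    set word :=
  [set a | words A a /\
     forall e : R, 0 < e ->
       exists b, [/\ M b, b <> a & word_dist R a b < e]].

Definition Mabs_lex : set word :=
  [set s | exists2 a, words tern a &
     is_sup (words tern) le_lex (range (fun n => absw (shift n a))) s].

Definition M_alt : set word :=
  [set s | exists2 a, words bin a &
     is_sup (words bin) le_alt (range (fun n => shift n a)) s].

Definition pi_base (R : realType) (q : R) (a : word) : R :=
  limn (series (fun n => (a n)%:~R * q ^- n.+1)).

Definition dist_int (R : realType) (x : R) : R :=
  inf (range (fun z : int => `|x - z%:~R|)).

Definition Ltilde (R : realType) (q : R) : set R :=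
  range (fun x : R => limn_sup (fun n => dist_int (x * q ^+ n))).

Definition tau02 (w : seq int) : seq int :=
  flatten [seq (if x == 0 then [:: 1] else [:: 1; 0; 0]) | x <- w].

(* Recursion on the last letter of a word given in reverse order: in the second
   branch [size v] is the length of the word preceding the letter x. *)
Fixpoint rho2_rev (v : seq int) : seq int :=
  if v is x :: v' then
    let s : int := if odd (size v') then -1 else 1 in
    rho2_rev v' ++ (if x == 0 then [:: s] else [:: s; 0])
  else [::].

Definition rho2 (w : seq int) : seq int := rho2_rev (rev w).

(* Extension to infinite words of a map f on finite words that is monotone for
   the prefix order and does not shorten words; [extendE] shows that every
   f (a_1 ... a_n) is then a prefix of [extend f a]. *)
Definition extend (f : seq int -> seq int) (a : word) : word :=
  fun n => nth 0 (f (mkseq a n.+1)) n.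

Lemma extendE (f : seq int -> seq int) (a : word) (n k : nat) :
    (forall u v, prefix (f u) (f (u ++ v))) ->
    (forall u, (size u <= size (f u))%N) ->
  (k < size (f (mkseq a n)))%N -> extend f a k = nth 0 (f (mkseq a n)) k.
Proof.
move=> fpre fsz kn; rewrite /extend.
have mk i j : mkseq a (i + j) = mkseq a i ++ [seq a l | l <- iota i j].
  by rewrite /mkseq iotaD map_cat.
have key i j l : (i <= j)%N -> (l < size (f (mkseq a i)))%N ->
    nth 0 (f (mkseq a j)) l = nth 0 (f (mkseq a i)) l.
  move=> /subnKC <- li; rewrite mk.
  by have /prefixP[t ->] := fpre (mkseq a i) [seq a l | l <- iota i (j - i)];
     rewrite nth_cat li.
case: (leqP n k.+1) => nk; first exact: key.
apply/esym/key; first exact: ltnW.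
by apply: leq_trans (fsz _); rewrite size_mkseq.
Qed.

Lemma rho2_rcons (w : seq int) (x : int) :
  rho2 (rcons w x) =
  rho2 w ++ (let s : int := if odd (size w) then -1 else 1 in
             if x == 0 then [:: s] else [:: s; 0]).
Proof. by rewrite /rho2 rev_rcons /= size_rev. Qed.

Lemma prefix_rho2 (u v : seq int) : prefix (rho2 u) (rho2 (u ++ v)).
Proof.
elim/last_ind: v => [|v x IH]; first by rewrite cats0 prefix_refl.
rewrite -rcons_cat rho2_rcons; exact: prefix_trans IH (prefix_prefix _ _).
Qed.

Lemma size_rho2 (u : seq int) : (size u <= size (rho2 u))%N.
Proof.
elim/last_ind: u => // u x IH.
by rewrite rho2_rcons size_rcons size_cat -addn1 leq_add //; case: (x == 0).
Qed.

Lemma prefix_iter_tau02 (n : nat) (u v : seq int) :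
  prefix (iter n tau02 u) (iter n tau02 (u ++ v)).
Proof.
have tau_cat s t : tau02 (s ++ t) = tau02 s ++ tau02 t.
  by rewrite /tau02 map_cat flatten_cat.
have -> : iter n tau02 (u ++ v) = iter n tau02 u ++ iter n tau02 v.
  by elim: n => [//|n IH] /=; rewrite IH.
exact: prefix_prefix.
Qed.

Lemma size_iter_tau02 (n : nat) (u : seq int) :
  (size u <= size (iter n tau02 u))%N.
Proof.
elim: n => //= n /leq_trans; apply.
elim: (iter n _ u) => //= x s IH; rewrite size_cat -add1n leq_add //.
by case: (x == 0).
Qed.

(* Main.v *)
Require Import Defs.
From mathcomp Require Import all_boot all_order all_algebra.
From mathcomp Require Import all_classical all_reals all_analysis.
From mathcomp Require Import zify ring lra.
Import Order.TTheory GRing.Theory Num.Theory.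
Import numFieldNormedType.Exports.
Local Open Scope classical_set_scope.
Local Open Scope ring_scope.

Set Implicit Arguments.
Unset Strict Implicit.
Unset Printing Implicit Defensive.
Local Notation shift := Defs.shift.

(** For a real x let z_n be the integer nearest to x q^n.  The digits
a_n = z_(n+1) - q z_n are integers and x q^n - z_n is the value pi_q of the tail
a_n a_(n+1) ..., so that every tail has a value in [-1/2, 1/2] and the limit
superior of the distances is that of the absolute values of the tails.  If
q <= 3, or if this limit superior is at most 1/(q-1), the digits are eventually
in {-1, 0, 1}.  On ternary words all of whose tails have values in [-1/2, 1/2],
pi_q is nondecreasing for the lexicographic order; hence the limit superior is
pi_q(s), where s is the lexicographic limit superior of the words
abs(a_n a_(n+1) ...) (lemmas [tails_limsup] and [Ltilde_Mabs_lex]).  This s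
dominates its own tails, abs(s_n s_(n+1) ...) <= s, and the words with this
property are exactly the elements of M^abs ([Mabs_lexP]).

Conversely, let s dominate its own tails, with pi_q(s) <= 1/2.  One needs a word
in which s recurs up to sign, while no limit of its tails exceeds s.  It is a
concatenation of signed prefixes of s, and the point is to find arbitrarily long
prefixes p_n that may be followed by s or -s ([bridge]).  Following p_n by e s is
harmless when all borders of p_n (suffixes that are, up to sign, prefixes of s)
have the sign -e, because -s is at most every tail of s.  When the longest border
of p_n cannot be prolonged to p_(n+1), a border-of-a-border argument shows that
all borders of p_(n+1) have the same sign ([border_fail]).  So either infinitely
many prefixes are suitable, or the longest border is prolonged for ever, and then
s is purely periodic up to sign and recurs by itself.  In base 2, where pi_q is
not monotone on all ternary words, the bound pi_q(s) <= 1/2 propagates to all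
words whose tails are dominated by s ([dominated_val_le_half]).

Below the accumulation point everything is governed by two substitutions.  A
nonzero element of M^abs below rho_2(m_alt) = 1 0 -1 1 ... has nonzero letters of
alternating signs with at most one 0 in between, hence is rho_2(t) for a binary
word t; and rho_2 carries the alternating order to the lexicographic one and
M_alt into M^abs ([desubst_rho], [rho_mono]).  Similarly an element of M_alt that
is below the fixed point m_alt = 1001... of tau_(0,2) and not 0 0 0 ... is the
image under tau_(0,2) of another such element ([desubst_tau], [tau_mono]), which
has a shorter common prefix with m_alt; so this descent reaches 0 0 0 ...
([M_alt_below]).  Thus the elements below m_alt are the iterates
tau_(0,2)^n(0 0 0 ...), which increase to m_alt.  Finally pi_q(rho_2(t)) lies in
(1/(2q), 1/q) and is strictly increasing in t ([val_rho_bounds],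
[val_rho_mono]), which carries the description over to the real line. *)

(** * Orders on words that compare the first differing letters *)

Definition agree (n : nat) (a b : word) : Prop :=
  forall k, (k < n)%N -> a k = b k.

Definition scalew (e : int) (a : word) : word := fun n => e * a n.

Definition is_sign (e : int) : Prop := e = 1 \/ e = -1.

(** Both orders of the statement are instances: the constant weight 1 gives the
lexicographic order and [(-1) ^+ n] the alternating one. *)
Definition ltw (sg : nat -> int) (n : nat) (a b : word) : Prop :=
  agree n a b /\ sg n * a n < sg n * b n.

Definition lew (sg : nat -> int) (a b : word) : Prop :=
  a = b \/ exists n, ltw sg n a b.

Definition sg_lex (n : nat) : int := 1.
Definition sg_alt (n : nat) : int := (-1) ^+ n.

Lemma is_signM e d : is_sign e -> is_sign d -> is_sign (e * d).
Proof. by case=> -> [] ->; rewrite ?mul1r ?mulN1r ?opprK; [left|right|right|left]. Qed.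

Lemma is_signK e : is_sign e -> e * e = 1.
Proof. by case=> ->. Qed.

Lemma is_signX e n : is_sign e -> is_sign (e ^+ n).
Proof.
move=> he; elim: n => [|n IH]; first by left.
by rewrite exprS; apply: is_signM.
Qed.

Lemma sg_lexP n : is_sign (sg_lex n). Proof. by left. Qed.

Lemma sg_altP n : is_sign (sg_alt n). Proof. by apply: is_signX; right. Qed.

Lemma scalew1 a : scalew 1 a = a.
Proof. by apply/funext => n; rewrite /scalew mul1r. Qed.

Lemma scalewN1 a : scalew (-1) a = oppw a.
Proof. by apply/funext => n; rewrite /scalew mulN1r. Qed.

Lemma scalewA e d a : scalew e (scalew d a) = scalew (e * d) a.
Proof. by apply/funext => n; rewrite /scalew mulrA. Qed.

Lemma scalewK e a : is_sign e -> scalew e (scalew e a) = a.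
Proof. by move=> /is_signK he; rewrite scalewA he scalew1. Qed.

Lemma shift0 a : shift 0 a = a. Proof. exact/funext. Qed.

Lemma shift_shift m n a : shift m (shift n a) = shift (n + m) a.
Proof. by apply/funext => k; rewrite /shift addnA. Qed.

Lemma shift_scalew n e a : shift n (scalew e a) = scalew e (shift n a).
Proof. exact/funext. Qed.

Lemma agree_sym n a b : agree n a b -> agree n b a.
Proof. by move=> h k /h. Qed.

Lemma agree_trans n a b c : agree n a b -> agree n b c -> agree n a c.
Proof. by move=> h h' k kn; rewrite h // h'. Qed.

Lemma agree_le m n a b : (m <= n)%N -> agree n a b -> agree m a b.
Proof. by move=> mn h k km; apply/h/(leq_trans km). Qed.

Lemma agree_scalew n e a b : agree n a b -> agree n (scalew e a) (scalew e b).
Proof. by move=> h k kn; rewrite /scalew h. Qed.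

Lemma agree_shift m n a b : agree (m + n) a b -> agree n (shift m a) (shift m b).
Proof. by move=> h k kn; rewrite /shift h // ltn_add2l. Qed.

Lemma agree_shift_sub m n a b :
  agree n a b -> agree (n - m) (shift m a) (shift m b).
Proof. by move=> h k kn; rewrite /shift h // -ltn_subRL. Qed.

Lemma agree_glue m n a b :
  agree m a b -> agree n (shift m a) (shift m b) -> agree (m + n) a b.
Proof.
move=> h h' k kmn; case: (ltnP k m) => [/h //|mk].
by have := h' (k - m)%N; rewrite /shift subnKC //; apply; rewrite ltn_subLR.
Qed.

Lemma agree_eq a b : (forall n, agree n a b) -> a = b.
Proof. by move=> h; apply/funext => n; apply: (h n.+1). Qed.

Lemma agree_first a b : a <> b -> exists2 n, agree n a b & a n <> b n.
Proof.
move=> ab; have : exists n, a n != b n.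
  by apply/not_existsP => h; apply/ab/funext => n; apply/eqP/negPn/negP/h.
move=> ex; case: (ex_minnP ex) => n /eqP nab mn; exists n => // k kn.
by apply/eqP/negPn/negP => /mn; rewrite leqNgt kn.
Qed.

Lemma sign_lt (s x y : int) : is_sign s -> x <> y -> s * x < s * y \/ s * y < s * x.
Proof. by case=> -> /eqP; rewrite neq_lt => /orP[] h; [left|right|right|left]; lia. Qed.

Section weighted_order.
Variable sg : nat -> int.
Hypothesis sgP : forall n, is_sign (sg n).

Lemma lew_refl a : lew sg a a. Proof. by left. Qed.

Lemma lew_total a b : lew sg a b \/ exists n, ltw sg n b a.
Proof.
have [->|/agree_first[n abn nab]] := pselect (a = b); first by left; left.
case: (sign_lt (sgP n) nab) => h; first by left; right; exists n.
by right; exists n; split => //; apply: agree_sym.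
Qed.

Lemma ltw_trans m n a b c :
  ltw sg m a b -> ltw sg n b c -> ltw sg (minn m n) a c.
Proof.
move=> [ab h] [bc h']; split.
  by apply: agree_trans (agree_le _ ab) (agree_le _ bc); lia.
case: (ltngtP m n) => mn.
- by rewrite -(bc m).
- by rewrite (ab n).
- by subst; apply: lt_trans h h'.
Qed.

Lemma ltw_irr n a : ~ ltw sg n a a.
Proof. by move=> [_]; rewrite ltxx. Qed.

Lemma lew_ltw_irr n a b : lew sg a b -> ~ ltw sg n b a.
Proof.
by case=> [->|[m h] h']; [exact: ltw_irr|exact: ltw_irr (ltw_trans h h')].
Qed.

Lemma lew_anti a b : lew sg a b -> lew sg b a -> a = b.
Proof. by move=> h [//|[n]] /(lew_ltw_irr h). Qed.

Lemma lew_trans a b c : lew sg a b -> lew sg b c -> lew sg a c.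
Proof.
move=> [->//|[m h]] [<-|[n h']]; right; first by exists m.
by exists (minn m n); apply: ltw_trans h h'.
Qed.

Lemma ltw_lew n a b : ltw sg n a b -> lew sg a b.
Proof. by right; exists n. Qed.

(** Membership in an open order interval is decided by finitely many letters. *)
Lemma ltw_agreel n a a' b : agree n.+1 a a' -> ltw sg n a b -> ltw sg n a' b.
Proof.
move=> aa' [ab h]; split; last by rewrite -aa'.
by apply: agree_trans ab; apply/agree_sym/agree_le/aa'.
Qed.

Lemma ltw_agreer n a b b' : agree n.+1 b b' -> ltw sg n a b -> ltw sg n a b'.
Proof.
move=> bb' [ab h]; split; last by rewrite -bb'.
by apply: agree_trans ab _; apply/agree_le/bb'.
Qed.

Lemma lew_le n a b : lew sg a b -> agree n a b -> sg n * a n <= sg n * b n.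
Proof.
move=> [->//|[m [h lt]]] ab; case: (ltngtP m n) => mn.
- by move: lt; rewrite ab // ltxx.
- by rewrite h.
- by subst; apply: ltW.
Qed.

End weighted_order.

Lemma le_lexE a b : le_lex a b <-> lew sg_lex a b.
Proof.
split=> [[->|[n [h lt]]]|[->|[n [h lt]]]]; try by left.
  by right; exists n; split => //; rewrite !mul1r.
by right; exists n; split => //; rewrite !mul1r in lt.
Qed.

Lemma le_altE a b : le_alt a b <-> lew sg_alt a b.
Proof.
have sgE n : sg_alt n = if odd n then -1 else 1.
  by rewrite /sg_alt -signr_odd; case: (odd n).
split=> [[->|[n [h lt]]]|[->|[n [h lt]]]]; try by left.
  right; exists n; split => //; rewrite sgE.
  by case: (odd n) lt => -[] [] // _ lt; lia.
right; exists n; split => //; move: lt; rewrite sgE.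
by case: (odd n) => lt; [right|left]; split => //; lia.
Qed.

Lemma ltw_shift_lex m n a b :
  agree m a b -> ltw sg_lex n (shift m a) (shift m b) -> ltw sg_lex (m + n) a b.
Proof. by move=> ab [h lt]; split => //; apply: agree_glue. Qed.

Lemma lew_glue_lex m a b :
  agree m a b -> lew sg_lex (shift m a) (shift m b) -> lew sg_lex a b.
Proof.
move=> ab [h|[n h]]; last by apply/ltw_lew/ltw_shift_lex/h.
left; apply: agree_eq => n; apply: (agree_le (leq_addl m n)).
by apply: agree_glue => // k _; rewrite h.
Qed.

(** * Limits superior of families of words *)

Lemma filter_all (T : Type) (F : set_system T) {FF : Filter F} (A : seq int)
    (P : int -> set T) :
  (forall c, c \in A -> F (P c)) -> F [set b | forall c, c \in A -> P c b].
Proof.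
elim: A => [|x A IH] FP.
  by apply: filterS filterT.
have Fx := FP x (mem_head _ _).
have FA := IH (fun c cA => FP c (mem_behead (s := x :: A) cA)).
apply: filterS (filterI Fx FA) => b [bx bA] c.
by rewrite in_cons => /orP[/eqP->|/bA].
Qed.

Lemma seq_max (P : int -> Prop) (e : int) (A : seq int) :
  (exists2 c, c \in A & P c) ->
  exists c, [/\ c \in A, P c & forall d, d \in A -> P d -> e * d <= e * c].
Proof.
elim: A => [|x A IH] [c]; first by rewrite in_nil.
have [/IH[m [mA Pm mM]] _ _|no] := pselect (exists2 c, c \in A & P c).
  have [[Px xm]|h] := pselect (P x /\ e * m <= e * x).
    exists x; split => //; first exact: mem_head.
    move=> d; rewrite in_cons => /orP[/eqP-> //|dA Pd].
    by apply: le_trans xm; apply: mM.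
  exists m; split => //; first by rewrite in_cons mA orbT.
  move=> d; rewrite in_cons => /orP[/eqP-> Px|]; last exact: mM.
  by rewrite leNgt; apply/negP => lt; apply: h; split => //; apply: ltW.
have only d : d \in x :: A -> P d -> d = x.
  by rewrite in_cons => /orP[/eqP //|dA Pd]; case: no; exists d.
move=> cA Pc; exists c; split => // d dA Pd.
by rewrite (only _ cA Pc) (only _ dA Pd).
Qed.

(** The greedy construction: having chosen a prefix that the filter meets, the
next letter is the largest one for which the filter still meets the extended
prefix.  Such a letter exists because the alphabet is finite; this is the
compactness of the space of words. *)
Lemma filter_limsup (sg : nat -> int) (F : set_system word) {FF : ProperFilter F}
    (A : seq int) : F (words A) ->
  exists s, [/\ words A s, forall k, ~ F (~` agree k s) &
                forall k, F (~` ltw sg k s)].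
Proof.
move=> FA.
pose pre p : set word := [set b | mkseq b (size p) = p].
have preS p (b : word) : pre p b -> pre (rcons p (b (size p))) b.
  by rewrite /pre /= size_rcons mkseqS => ->.
pose best p : set int := [set c | [/\ c \in A, ~ F (~` pre (rcons p c)) &
  forall d, d \in A -> ~ F (~` pre (rcons p d)) -> sg (size p) * d <= sg (size p) * c]].
have ex_best p : ~ F (~` pre p) -> exists c, best p c.
  move=> Fp; apply: seq_max; apply: contrapT => no; apply: Fp.
  have /filter_all/(filterI FA) : forall c, c \in A -> F (~` pre (rcons p c)).
    by move=> c cA; apply: contrapT => h; apply: no; exists c.
  by apply: filterS => b [bA h] /preS; apply: h.
pose next p := xget 0 (best p).
pose G k := iter k (fun p => rcons p (next p)) [::].
pose s k := next (G k).
have sizeG k : size (G k) = k by elim: k => //= k IH; rewrite size_rcons IH.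
have GE k : G k = mkseq s k by elim: k => // k IH; rewrite mkseqS -IH.
have freqG k : ~ F (~` pre (G k)).
  elim: k => [|k /ex_best/(xgetPex 0)[] //].
  by apply: contra_not (@filter_not_empty _ _ FF); apply: filterS => b; apply.
have bestP k : best (G k) (s k) by apply: (@xgetPex _ 0 (best (G k))); apply/ex_best/freqG.
have preG k b : pre (G k) b <-> agree k s b.
  rewrite /pre /= sizeG GE; split => [h i ik|h].
    by rewrite -(nth_mkseq 0 s ik) -h nth_mkseq.
  apply: (@eq_from_nth _ 0); rewrite !size_mkseq // => i ik.
  by rewrite !nth_mkseq // h.
exists s; split => k.
- by have [] := bestP k.
- apply: contra_not (freqG k); apply: filterS => b; apply: contra_not.
  by move/preG.
- have [_ _ max] := bestP k; rewrite sizeG in max.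
  have /filter_all/(filterI FA) : forall d, d \in A ->
      F (~` [set b | pre (rcons (G k) d) b /\ sg k * s k < sg k * d]).
    move=> d dA; apply: contrapT => h.
    have [lt|nlt] := pselect (sg k * s k < sg k * d); last first.
      by case: h; apply: filterS filterT => b _ [].
    have /(max d dA) : ~ F (~` pre (rcons (G k) d)).
      by apply: contra_not h; apply: filterS => b nb [].
    by rewrite leNgt lt.
  apply: filterS => b [bA h] [sb lt]; apply: (h (b k)) => //; split => //.
  by rewrite -{2}(sizeG k); apply: preS; apply/preG.
Qed.

(** A supremum need not belong to the family, but all its prefixes occur in it:
the greedy word built along the filter of sets that contain S is a least upper
bound with this property, and the order is antisymmetric. *)
Lemma is_sup_attained (sg : nat -> int) (sgP : forall n, is_sign (sg n))
    (A : seq int) (S : set word) (s : word) :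
  S `<=` words A -> S !=set0 -> is_sup (words A) (lew sg) S s ->
  [/\ words A s, forall k, exists2 b, S b & agree k s b & forall b, S b -> lew sg b s].
Proof.
move=> SA [b0 Sb0] [As ub least]; split => //.
have FS := globally_properfilter Sb0.
have [s' [As' att no]] := filter_limsup sg (F := globally S) SA.
have ub' b : S b -> lew sg b s'.
  move=> Sb; case: (lew_total sgP b s') => // -[k h].
  by case: (no k b Sb).
have att' k : exists2 b, S b & agree k s' b.
  apply: contrapT => h; apply: (att k) => b Sb ab; apply: h; by exists b.
suff -> : s = s' by [].
apply: (lew_anti (sg := sg)); first exact: least.
case: (lew_total sgP s' s) => // -[k lt].
have [b Sb sb] := att' k.+1.
by case: (lew_ltw_irr (ub b Sb) (ltw_agreer sb lt)).
Qed.

Lemma sup_of_max (sg : nat -> int) (A : seq int) (S : set word) (s : word) :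
  words A s -> S s -> (forall b, S b -> lew sg b s) -> is_sup (words A) (lew sg) S s.
Proof. by move=> As Ss ub; split => // u _; apply. Qed.

(** * Self-dominated words *)

(** Equivalent to abs(b) <= s, but symmetric in b and -b. *)
Definition dominated (s b : word) : Prop :=
  forall e, is_sign e -> lew sg_lex (scalew e b) s.

Definition tails_dominated (s b : word) : Prop :=
  forall k, dominated s (shift k b).

Lemma words_shift A n a : words A a -> words A (shift n a).
Proof. by move=> h k; apply: h. Qed.

Lemma ternN (x : int) : x \in tern -> - x \in tern.
Proof. by rewrite !inE => /or3P[] /eqP ->. Qed.

Lemma words_scalew e a : is_sign e -> words tern a -> words tern (scalew e a).
Proof. by case=> -> h n; rewrite /scalew ?mul1r ?mulN1r //; apply/ternN. Qed.

Lemma dominated_scalew s e b :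
  is_sign e -> dominated s b -> dominated s (scalew e b).
Proof. by move=> he h d hd; rewrite scalewA; apply/h/is_signM. Qed.

Lemma tails_dominated_scalew s e b :
  is_sign e -> tails_dominated s b -> tails_dominated s (scalew e b).
Proof. by move=> he h k; rewrite shift_scalew; apply: dominated_scalew. Qed.

Lemma tails_dominated_shift s n b : tails_dominated s b -> tails_dominated s (shift n b).
Proof. by move=> h k; rewrite shift_shift. Qed.

Lemma lew_opp a b : lew sg_lex a b -> lew sg_lex (scalew (-1) b) (scalew (-1) a).
Proof.
move=> [->|[n [h lt]]]; first by left.
right; exists n; split; first exact/agree_scalew/agree_sym.
by move: lt; rewrite /scalew !mulN1r !mul1r ltrN2.
Qed.

Lemma absw_sign a : exists2 e, is_sign e & absw a = scalew e a.
Proof.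
rewrite /absw; case: asboolP => _; first by exists 1; [left|rewrite scalew1].
by exists (-1); [right|rewrite scalewN1].
Qed.

Lemma scalew_zerow e : scalew e zerow = zerow.
Proof. by apply/funext => n; rewrite /scalew mulr0. Qed.

Lemma zerow_le_absw a : lew sg_lex zerow (absw a).
Proof.
rewrite /absw; case: asboolP => [/le_lexE //|h].
case: (lew_total sg_lexP zerow a) => [/le_lexE //|[k]].
by move=> /ltw_lew/lew_opp; rewrite scalew_zerow scalewN1.
Qed.

Lemma absw_ge a : dominated (absw a) a.
Proof.
have := zerow_le_absw a; have [e he ->] := absw_sign a => e0 d hd.
have [->|->] : d = e \/ d = - e.
- by case: he hd => -> [] ->; rewrite ?opprK; [left|right|right|left].
- exact: lew_refl.
apply: (lew_trans _ e0).
by have := lew_opp e0; rewrite scalew_zerow scalewA mulN1r.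
Qed.

Lemma absw_le a s : lew sg_lex (absw a) s <-> dominated s a.
Proof.
split=> [h e he|h]; first exact: lew_trans (@absw_ge a e he) h.
by have [e he ->] := absw_sign a; apply: h.
Qed.

Lemma range_absw_tern a : words tern a ->
  range (fun n => absw (shift n a)) `<=` words tern.
Proof.
move=> ta _ [n _ <-]; have [e he ->] := absw_sign (shift n a).
exact/words_scalew/words_shift.
Qed.

Lemma is_sup_lex A S s : is_sup (words A) le_lex S s <-> is_sup (words A) (lew sg_lex) S s.
Proof.
have -> // : le_lex = lew sg_lex.
by apply/funext => a; apply/funext => b; apply/propext/le_lexE.
Qed.

Lemma is_sup_alt A S s : is_sup (words A) le_alt S s <-> is_sup (words A) (lew sg_alt) S s.
Proof.
have -> // : le_alt = lew sg_alt.
by apply/funext => a; apply/funext => b; apply/propext/le_altE.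
Qed.

(** If a prefix of a tail of s exceeded s, so would the corresponding tail of any
member of the family that shares a long enough prefix with s. *)
Lemma Mabs_lexP s : Mabs_lex s <-> words tern s /\ tails_dominated s s.
Proof.
split=> [[a ta /is_sup_lex sup]|[ts ds]]; last first.
  exists s => //; apply/is_sup_lex; apply: sup_of_max => //.
    exists 0%N => //; rewrite shift0; apply: (lew_anti (sg := sg_lex)).
      by apply/absw_le; have := ds 0%N; rewrite shift0.
    by rewrite -[X in lew _ X _]scalew1; apply: absw_ge; left.
  by move=> _ [n _ <-]; apply/absw_le.
have [] := is_sup_attained sg_lexP (range_absw_tern ta) _ sup.
  by exists (absw (shift 0 a)); exists 0%N.
move=> ts att ub; split => // k e he.
case: (lew_total sg_lexP (scalew e (shift k s)) s) => // -[i lt].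
have [_ [n _ <-] sb] := att (k + i.+1)%N.
have [d hd absE] := absw_sign (shift n a).
have lt' := ltw_agreer (agree_scalew e (agree_shift sb)) lt.
exfalso; apply: lew_ltw_irr lt'.
rewrite absE shift_scalew shift_shift scalewA.
apply: lew_trans (ub (absw (shift (n + k) a)) _); last by exists (n + k)%N.
exact/absw_ge/is_signM.
Qed.

Lemma M_altP s :
  M_alt s <-> words bin s /\ forall k, lew sg_alt (shift k s) s.
Proof.
split=> [[a ta /is_sup_alt sup]|[ts ds]]; last first.
  exists s => //; apply/is_sup_alt; apply: sup_of_max => //.
    by exists 0%N => //; rewrite shift0.
  by move=> _ [n _ <-]; apply: ds.
have [] := is_sup_attained sg_altP _ _ sup.
- by move=> _ [n _ <-]; apply: words_shift.
- by exists (shift 0 a); exists 0%N.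
move=> ts att ub; split => // k.
case: (lew_total sg_altP (shift k s) s) => // -[i lt].
have [_ [n _ <-] sb] := att (k + i.+1)%N.
exfalso; apply: lew_ltw_irr (ltw_agreer (agree_shift sb) lt).
by rewrite shift_shift; apply: ub; exists (n + k)%N.
Qed.

(** * Realising a self-dominated word as a limit superior *)

Definition catw (n : nat) (a b : word) : word :=
  fun k => if (k < n)%N then a k else b (k - n)%N.

Lemma agree_catw n a b : agree n (catw n a b) a.
Proof. by move=> k kn; rewrite /catw kn. Qed.

Lemma shift_catw n a b : shift n (catw n a b) = b.
Proof. by apply/funext => k; rewrite /Defs.shift /catw ltnNge leq_addr addKn. Qed.

Lemma catw_shift n a : catw n a (shift n a) = a.
Proof.
apply/funext => k; rewrite /Defs.shift /catw; case: ltnP => // nk.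
by rewrite subnKC.
Qed.

(** A border, in the sense of combinatorics on words, of the prefix of length n
of s, up to the sign d; it is given by its starting point k. *)
Definition border (s : word) (n k : nat) (d : int) : Prop :=
  [/\ (0 < k < n)%N, is_sign d & agree (n - k) (shift k s) (scalew d s)].

Section bridge.
Variable s : word.
Hypothesis ds : tails_dominated s s.

(** If all borders of the prefix have the sign opposite to e, the word e s may
be appended: every tail that starts inside the prefix is either already
decided, or continues a border d = -e, and then d e s = -s is at most the
actual continuation in s. *)
Lemma border_sign_extend n e : is_sign e ->
  (forall k d, border s n k d -> d = - e) ->
  forall k, (0 < k)%N -> dominated s (shift k (catw n s (scalew e s))).
Proof.
move=> he good k k0; case: (leqP n k) => nk.
  rewrite -(subnKC nk) -shift_shift shift_catw shift_scalew.
  exact: dominated_scalew.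
move=> d hd; set b := shift k _.
have bs : agree (n - k) b (shift k s) by apply/agree_shift_sub/agree_catw.
have glue : agree (n - k) (scalew d b) s -> lew sg_lex (scalew d b) s.
  move=> ag; apply: (lew_glue_lex ag).
  have de : d = - e.
    apply: (good k); split => //; first by rewrite k0.
    move=> i ik; move: (ag i ik); rewrite /scalew bs // => <-.
    by rewrite mulrA is_signK // mul1r.
  rewrite shift_scalew /b shift_shift (subnKC (ltnW nk)) shift_catw scalewA de.
  rewrite mulNr is_signK //.
  have := @ds (n - k)%N (-1) (or_intror erefl).
  by move/lew_opp; rewrite scalewA mulrNN mulr1 scalew1.
have := @ds k d hd; case=> [E|[i [ag lt]]].
  apply: glue => i ik; rewrite /scalew bs //; have := congr1 (fun w => w i) E.
  exact.
case: (ltnP i (n - k)) => ik.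
  apply: (@ltw_lew _ i); apply: ltw_agreel (conj ag lt).
  exact/agree_scalew/agree_sym/agree_le/bs.
apply: glue => j jk; rewrite /scalew bs //; apply: ag; exact: leq_trans ik.
Qed.

(** When the longest border, of sign d, cannot be prolonged, every border of
the longer prefix has the sign -d: a border with sign d would be a border of
the longest one, and the failure would contradict domination there. *)
Lemma border_fail n k d : border s n k d ->
  (forall k' d', border s n k' d' -> (k <= k')%N) ->
  ~ border s n.+1 k d ->
  forall k' d', border s n.+1 k' d' -> d' = - d.
Proof.
move=> [/andP[k0 kn] hd bk] min fail k' d' [/andP[k'0 k'n] hd' bk'].
have [//|dd'] : d' = - d \/ d' = d.
  by case: hd hd' => -> [] ->; rewrite ?opprK; [right|left|left|right].
subst d'; exfalso.
have lt : s (n - k)%N != d * s n.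
  apply/eqP => E; apply: fail; split=> //; first by rewrite k0 ltnW.
  move=> i; rewrite (subSn (ltnW kn)) ltnS leq_eqVlt => /orP[/eqP ->|/bk //].
  by rewrite /Defs.shift (subnKC (ltnW kn)) /scalew E mulrA is_signK ?mul1r.
have {}lt : d * s n < s (n - k)%N.
  rewrite lt_neqAle eq_sym lt /=.
  have bk2 : agree (n - k) (scalew d (shift k s)) s.
    by move=> i ik; rewrite /scalew bk // mulrA is_signK // mul1r.
  have := lew_le (@ds k d hd) bk2.
  by rewrite /scalew /Defs.shift !mul1r subnKC // ltnW.
have kk' : (k < k')%N.
  have [k'ln|nk'] := ltnP k' n; last by lia.
  have kk' : (k <= k')%N.
    apply: (min _ d); split=> //; first by rewrite k'0.
    by apply: agree_le bk'; lia.
  rewrite ltn_neqAle kk' andbT; apply/eqP => E; apply: fail; rewrite E.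
  by split=> //; rewrite k'0.
have E1 : s (n - k')%N = d * s n.
  have := bk' (n - k')%N; rewrite /Defs.shift subnKC // => ->; last by lia.
  by rewrite /scalew mulrA is_signK // mul1r.
have ag : agree (n - k') (scalew 1 (shift (k' - k) s)) s.
  move=> i ik; rewrite /scalew mul1r.
  have e1 : shift k' s i = d * s i by apply: bk'; lia.
  have e2 : shift k s (k' - k + i)%N = d * s (k' - k + i)%N by apply: bk; lia.
  rewrite /Defs.shift in e1 e2 *; move: e2.
  rewrite (_ : (k + (k' - k + i))%N = (k' + i)%N) ?e1; last by lia.
  by case: hd => ->; lia.
have := lew_le (@ds (k' - k)%N 1 (or_introl erefl)) ag.
rewrite /sg_lex /scalew /Defs.shift !mul1r E1.
by rewrite (_ : (k' - k + (n - k'))%N = (n - k)%N); lia.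
Qed.

(** If from some length on no prefix has all its borders of one sign, then by
[border_fail] the longest border of each prefix is prolonged by the next letter;
its starting point never changes. *)
Lemma border_forever N : (0 < N)%N ->
  (forall n e, (N <= n)%N -> is_sign e ->
     exists k d, border s n k d /\ d <> - e) ->
  exists k d, [/\ (0 < k)%N, is_sign d & shift k s = scalew d s].
Proof.
move=> N0 bad.
pose hasb n k := `[< exists d, border s n k d >].
have ex : exists k, hasb N k.
  have [k [d [h _]]] := bad N 1 (leqnn _) (or_introl erefl).
  by exists k; apply/asboolP; exists d.
case: (ex_minnP ex) => k /asboolP[d bd] min.
have [/andP[k0 kN] hd _] := bd.
have all m : border s (N + m) k d /\
             (forall k' d', border s (N + m) k' d' -> (k <= k')%N).
  elim: m => [|m [IH1 IH2]].
    by rewrite addn0; split => // k' d' h; apply/min/asboolP; exists d'.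
  rewrite addnS; split.
    apply: contrapT => fail.
    have [k' [d' [b' []]]] := bad (N + m).+1 d (leqW (leq_addr _ _)) hd.
    exact: border_fail IH1 IH2 fail _ _ b'.
  move=> k' d' [/andP[k'0 k'n] hd' b']; case: (leqP k k') => // k'k.
  have : (k <= k')%N; last by lia.
  apply: (IH2 k' d'); split=> //; first by lia.
  by apply: agree_le b'; lia.
exists k, d; split=> //; apply: agree_eq => n.
by have [[_ _]] := (all n).1; apply: agree_le; lia.
Qed.

Lemma shift_mul_period k d m :
  shift k s = scalew d s -> shift (k * m) s = scalew (d ^+ m) s.
Proof.
move=> E; elim: m => [|m IH]; first by rewrite muln0 shift0 scalew1.
rewrite mulnS -shift_shift E shift_scalew IH scalewA.
by rewrite exprS.
Qed.

(** The tail k = 0 is excluded, since p_n s may be greater than s; it tends to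
s as n grows, which suffices for limits superior. *)
Lemma bridge N : exists n e, [/\ (N < n)%N, is_sign e &
  forall k, (0 < k)%N -> dominated s (shift k (catw n s (scalew e s)))].
Proof.
have [[n [e [Nn he good]]]|no] := pselect (exists n e, [/\ (N < n)%N, is_sign e &
    forall k d, border s n k d -> d = - e]).
  by exists n, e; split => //; apply: border_sign_extend.
have [|k [d [k0 hd E]]] := @border_forever N.+1 (ltn0Sn _).
  move=> n e Nn he; apply: contrapT => h; apply: no; exists n, e; split=> //.
  by move=> k d b; apply: contrapT => dn; apply: h; exists k, d.
exists (k * N.+1)%N, (d ^+ N.+1); split.
- by rewrite leq_pmull.
- exact: is_signX.
- by move=> j _; rewrite -(shift_mul_period N.+1 E) catw_shift; apply: ds.
Qed.

End bridge.

(** The concatenation e_0 p_0 e_1 p_1 ... of signed prefixes of s is produced by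
a machine whose state (i, j, h) says that letter j of the i-th block is next
and that the current sign is h. *)
Section concatenation.
Variables (s : word) (n : nat -> nat) (e : nat -> int).
Hypothesis n_gt : forall i, (i < n i)%N.
Hypothesis eP : forall i, is_sign (e i).

Definition block_step (st : nat * nat * int) : nat * nat * int :=
  let: (i, j, h) := st in
  if (j.+1 < n i)%N then (i, j.+1, h) else (i.+1, 0%N, h * e i).

Definition block_word (st : nat * nat * int) : word :=
  fun m => let: (i, j, h) := iter m block_step st in h * s j.

Definition block_valid (st : nat * nat * int) : Prop :=
  let: (i, j, h) := st in (j < n i)%N /\ is_sign h.

Lemma shift_block_word m st :
  shift m (block_word st) = block_word (iter m block_step st).
Proof.
by apply/funext => k; rewrite /Defs.shift /block_word addnC iterD.
Qed.

Lemma block_step_valid st : block_valid st -> block_valid (block_step st).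
Proof.
case: st => [[i j] h] [jn hh] /=; case: ltnP => // _; split.
  exact: leq_ltn_trans (n_gt _).
exact: is_signM.
Qed.

Lemma iter_block_valid m st : block_valid st -> block_valid (iter m block_step st).
Proof. by move=> h; elim: m => //= m; apply: block_step_valid. Qed.

Lemma iter_block_in i j h m :
  (j + m < n i)%N -> iter m block_step (i, j, h) = (i, (j + m)%N, h).
Proof.
elim: m => [|m IH]; first by rewrite addn0.
by rewrite addnS => lt; rewrite iterS IH ?(ltnW lt) //= lt.
Qed.

Lemma iter_block_out i j h : (j < n i)%N ->
  iter (n i - j) block_step (i, j, h) = (i.+1, 0%N, h * e i).
Proof.
move=> jn; rewrite (_ : (n i - j = (n i - j).-1.+1)%N); last by lia.
rewrite iterS iter_block_in; last by lia.
by rewrite /= (_ : ((j + (n i - j).-1).+1 = n i)%N) ?ltnn; last by lia.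
Qed.

Lemma agree_block_start i h : agree (n i) (block_word (i, 0%N, h)) (scalew h s).
Proof. by move=> k kn; rewrite /block_word iter_block_in. Qed.

Lemma agree_block i j h : (j < n i)%N ->
  agree (n i - j + n i.+1) (block_word (i, j, h))
        (scalew h (shift j (catw (n i) s (scalew (e i) s)))).
Proof.
move=> jn; apply: agree_glue.
  move=> k kn; rewrite /block_word iter_block_in; last by lia.
  by rewrite /scalew /Defs.shift /catw (_ : (j + k < n i)%N) //; lia.
rewrite shift_block_word iter_block_out // shift_scalew shift_shift.
rewrite subnKC; last exact: ltnW.
by rewrite shift_catw scalewA; apply: agree_block_start.
Qed.

Definition block_index (st : nat * nat * int) : nat := st.1.1.

Lemma block_index_mono m st : (block_index st <= block_index (iter m block_step st))%N.
Proof.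
elim: m => //= m /leq_trans; apply; case: (iter m _ _) => [[i j] h] /=.
by case: ifP.
Qed.

Lemma block_reach i : exists m h, is_sign h /\
  iter m block_step (0%N, 0%N, 1) = (i, 0%N, h).
Proof.
elim: i => [|i [m [h [hh E]]]]; first by exists 0%N, 1; split => //; left.
exists (n i + m)%N, (h * e i); split; first exact: is_signM.
by rewrite iterD E -{1}(subn0 (n i)) iter_block_out // (leq_ltn_trans _ (n_gt i)).
Qed.

End concatenation.

(** Concatenating prefixes of s of increasing length, each followed by a signed
copy of s in the sense of [bridge], produces a word whose tails look more and
more like tails of some p_n (e s).  Tails that start at the beginning of a block
are compared with s itself, since p_n (e s) may exceed s. *)
Lemma limit_tails_dominated s : words tern s -> tails_dominated s s ->
  exists a, [/\ words tern a,
    forall I, exists T, forall t, (T <= t)%N ->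
      exists b, [/\ words tern b, tails_dominated s b & agree I (shift t a) b] &
    forall I T, exists t e, [/\ (T <= t)%N, is_sign e &
      agree I (shift t a) (scalew e s)]].
Proof.
move=> ts ds; have /choice[n /choice[e ne]] := bridge ds.
have n_gt i : (i < n i)%N by have [] := ne i.
have eP i : is_sign (e i) by have [] := ne i.
have valid0 : block_valid n (0%N, 0%N, 1) by split; [exact: n_gt|left].
exists (block_word s n e (0%N, 0%N, 1)).
have tcat i : words tern (catw (n i) s (scalew (e i) s)).
  by move=> k; rewrite /catw; case: ifP => // _; apply: words_scalew.
split.
- move=> t; rewrite /block_word.
  case E: (iter _ _ _) => [[i j] h].
  have := iter_block_valid n_gt eP t valid0; rewrite E => -[_ hh].
  exact: words_scalew.
- move=> I; have [T [h [hh E]]] := block_reach n_gt eP I; exists T => t Tt.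
  rewrite shift_block_word.
  case E': (iter t _ _) => [[i j] h'].
  have := iter_block_valid n_gt eP t valid0; rewrite E' => -[jn hh'].
  have Ii : (I <= i)%N.
    have := block_index_mono n e (t - T) (I, 0%N, h).
    by rewrite -{2}E -iterD subnK // E'.
  case: (posnP j) => j0.
    exists (scalew h' s); split; [exact: words_scalew| |].
      exact: tails_dominated_scalew.
    rewrite j0; apply: agree_le (@agree_block_start s n e i h').
    exact: leq_trans Ii (ltnW (n_gt i)).
  exists (scalew h' (shift j (catw (n i) s (scalew (e i) s)))); split.
  + exact/words_scalew/words_shift/tcat.
  + apply: tails_dominated_scalew => // k; rewrite shift_shift.
    by have [_ _] := ne i; apply; rewrite addn_gt0 j0.
  + apply: agree_le (@agree_block s n e i j h' jn).
    by have := n_gt i.+1; lia.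
- move=> I T; have [t [h [hh E]]] := block_reach n_gt eP (maxn I T).
  exists t, h; split=> //; last first.
    rewrite shift_block_word E; apply: agree_le (@agree_block_start s n e _ h).
    by have := n_gt (maxn I T); lia.
  have idx m : (block_index (iter m (block_step n e) (0%N, 0%N, 1%R)) <= m)%N.
    elim: m => //= m; rewrite /block_index; case: (iter m _ _) => [[i j] h''] /=.
    by case: ifP => _ im; [exact: leqW|exact: im].
  by have := idx t; rewrite E /block_index /=; lia.
Qed.

(** * Values of ternary words in an integer base *)

Section value.
Variables (R : realType) (q : nat).
Hypothesis q2 : (2 <= q)%N.
Local Notation Q := (q%:R : R).
Local Notation val := (pi_base Q).

Lemma base_ge2 : 2 <= Q.
Proof. by rewrite ler_nat. Qed.

Lemma base_gt0 : 0 < Q.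
Proof. exact: lt_le_trans base_ge2. Qed.

Let Q2 := base_ge2.
Let Q0 := base_gt0.

Lemma base_neq0 : Q != 0. Proof. by rewrite gt_eqF. Qed.

Lemma base_sub1_gt0 : 0 < Q - 1.
Proof. by have := Q2; lra. Qed.

Let Qn0 := base_neq0.
Let Q10 := base_sub1_gt0.

Lemma digit_le1 (x : int) : x \in tern -> `|x%:~R : R| <= 1.
Proof.
by rewrite !inE => /or3P[] /eqP ->; rewrite ?rmorphN1 ?normrN ?normr0 ?normr1.
Qed.

Lemma intr_lt_succ (x y : int) : x < y -> x%:~R + 1 <= y%:~R :> R.
Proof. by move=> xy; rewrite -[1]/(1%:~R) -intrD ler_int lezD1. Qed.

Let term (a : word) (n : nat) : R := (a n)%:~R * Q ^- n.+1.

Lemma series_termS a n :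
  series (term a) n.+1 = (a 0%N)%:~R / Q + Q^-1 * series (term (shift 1 a)) n.
Proof.
rewrite !seriesEnat /= big_nat_recl // mulr_sumr; congr (_ + _).
apply: eq_bigr => i _; rewrite /term /Defs.shift add1n (exprS _ i.+1) invfM.
by rewrite mulrCA.
Qed.

Lemma series_term_bound a n : words tern a ->
  `|series (term a) n| <= 1 / (Q - 1).
Proof.
elim: n a => [|n IH] a ta.
  by rewrite seriesEnat /= big_geq // normr0 divr_ge0 // ltW.
rewrite series_termS; apply: (le_trans (ler_normD _ _)).
have -> : 1 / (Q - 1) = 1 / Q + Q^-1 * (1 / (Q - 1)).
  by field; rewrite Qn0 gt_eqF.
have Qi : 0 < Q^-1 by rewrite invr_gt0.
apply: lerD; rewrite normrM (gtr0_norm Qi).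
  by apply: ler_wpM2r; [exact: ltW|exact: digit_le1].
by apply: ler_wpM2l; [exact: ltW|exact/IH/words_shift].
Qed.

Lemma is_cvg_series_term a : words tern a -> cvgn (series (term a)).
Proof.
move=> ta; apply: normed_cvg.
have Qi : `|Q^-1| < 1.
  by rewrite gtr0_norm ?invr_gt0 // invf_lt1 //; have := Q2; lra.
apply: series_le_cvg (is_cvg_geometric_series (a := Q^-1) Qi) => n.
- exact: normr_ge0.
- by rewrite /geometric /= mulr_ge0 ?exprn_ge0 // invr_ge0 ltW.
rewrite /geometric /= /term normrM exprS invfM [X in _ * X]ger0_norm; last first.
  by rewrite mulr_ge0 // invr_ge0 ?exprn_ge0 ltW.
by rewrite exprVn ler_piMl // digit_le1.
Qed.

Lemma valE a : val a = limn (series (term a)). Proof. by []. Qed.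

Lemma val_rec a : words tern a -> val a = ((a 0%N)%:~R + val (shift 1 a)) / Q.
Proof.
move=> ta; rewrite !valE; apply: cvg_lim => //.
rewrite -cvg_shiftS mulrDl [X in _ + X]mulrC.
have -> : [sequence series (term a) n.+1]_n =
    (fun n => (a 0%N)%:~R / Q + Q^-1 * series (term (shift 1 a)) n).
  by apply/funext => n /=; rewrite series_termS.
apply: cvgD; first exact: cvg_cst.
by apply: cvgMr; apply: is_cvg_series_term; apply: words_shift.
Qed.

Lemma val_bound a : words tern a -> `|val a| <= 1 / (Q - 1).
Proof.
move=> ta; have c := is_cvg_series_term ta.
rewrite ler_norml valE; apply/andP; split.
  apply: limr_ge c _; apply: nearW => n.
  by have := series_term_bound n ta; rewrite ler_norml => /andP[].
apply: limr_le c _; apply: nearW => n.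
by have := series_term_bound n ta; rewrite ler_norml => /andP[].
Qed.

Lemma inv_base_sub1_le1 : 1 / (Q - 1) <= 1.
Proof. by rewrite ler_pdivrMr //; have := Q2; lra. Qed.

Lemma val_le1 a : words tern a -> `|val a| <= 1.
Proof. move=> ta; exact: le_trans (val_bound ta) inv_base_sub1_le1. Qed.

Lemma small_power (C e : R) : 0 < e -> exists n, forall m, (n <= m)%N -> C / Q ^+ m < e.
Proof.
move=> e0; have Qi : `|Q^-1| < 1.
  by rewrite gtr0_norm ?invr_gt0 // invf_lt1 //; have := Q2; lra.
have /cvgrPdist_lt/(_ e e0)[n _ h] := cvg_geometric C Qi.
exists n => m nm; have := h m nm.
by rewrite /= sub0r normrN exprVn; apply: le_lt_trans (ler_norm _).
Qed.

Lemma le_small_power (x y C : R) : (forall n, x <= y + C / Q ^+ n) -> x <= y.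
Proof.
move=> h; rewrite leNgt; apply/negP; rewrite -subr_gt0 => /(small_power C)[n].
by move=> /(_ n (leqnn _)); have := h n; lra.
Qed.

(** A bounded solution of the recurrence satisfied by the values of the tails
is the sequence of these values, since the error is multiplied by q at each
step. *)
Lemma val_unique a (e : nat -> R) (C : R) : words tern a ->
  (forall n, `|e n| <= C) ->
  (forall n, e n = ((a n)%:~R + e n.+1) / Q) -> forall n, e n = val (shift n a).
Proof.
move=> ta eC erec n.
have vrec m : val (shift m a) = ((a m)%:~R + val (shift m.+1 a)) / Q.
  rewrite val_rec; last exact: words_shift.
  by rewrite /Defs.shift addn0 (_ : (fun _ => _) = shift m.+1 a) // /Defs.shift;
    apply/funext => k; rewrite addnA addn1.
have err m k : `|e m - val (shift m a)| <= (C + 1) / Q ^+ k.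
  elim: k m => [|k IH] m.
    rewrite expr0 divr1; apply: le_trans (ler_normB _ _) _.
    by apply: lerD; rewrite ?val_le1 //; apply: words_shift.
  have -> : e m - val (shift m a) = (e m.+1 - val (shift m.+1 a)) / Q.
    by rewrite erec vrec; field.
  rewrite normrM normfV (gtr0_norm Q0) exprSr invfM mulrA.
  by rewrite ler_pM2r ?invr_gt0.
apply/eqP; rewrite -subr_eq0 -normr_le0.
by apply: (@le_small_power _ _ (C + 1)) => k; rewrite add0r.
Qed.

Lemma val_shift_rec a n : words tern a ->
  val (shift n a) = ((a n)%:~R + val (shift n.+1 a)) / Q.
Proof.
move=> ta; rewrite val_rec; last exact: words_shift.
by rewrite shift_shift addn1 /Defs.shift addn0.
Qed.

Lemma val_scalew e a : is_sign e -> words tern a ->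
  val (scalew e a) = e%:~R * val a.
Proof.
move=> he ta; rewrite -[scalew e a]shift0 -{2}[a]shift0.
rewrite -(@val_unique _ (fun n => e%:~R * val (shift n a)) 1) //.
- exact: words_scalew.
- move=> n; rewrite normrM.
  have -> : `|e%:~R : R| = 1 by case: he => ->; rewrite ?rmorphN1 ?normrN normr1.
  by rewrite mul1r val_le1 //; apply: words_shift.
- move=> n; rewrite val_shift_rec // mulrA mulrDr; congr ((_ + _) / _).
  by rewrite /scalew rmorphM.
Qed.

Lemma norm_val_scalew e a : is_sign e -> words tern a ->
  `|val (scalew e a)| = `|val a|.
Proof.
move=> he ta; rewrite val_scalew // normrM.
by case: he => ->; rewrite ?rmorphN1 ?normrN normr1 mul1r.
Qed.

Lemma val_zerow : val zerow = 0.
Proof.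
rewrite -[zerow]shift0 -(@val_unique _ (fun _ => 0) 0) // => n.
by rewrite normr0.
by rewrite add0r mul0r.
Qed.

Lemma val_agree n a b : words tern a -> words tern b -> agree n a b ->
  `|val a - val b| <= 2 / Q ^+ n.
Proof.
elim: n a b => [|n IH] a b ta tb ab.
  rewrite expr0 divr1; apply: le_trans (ler_normB _ _) _.
  by have := val_le1 ta; have := val_le1 tb; lra.
rewrite (val_rec ta) (val_rec tb) ab //.
rewrite -mulrBl opprD addrACA subrr add0r.
rewrite normrM normfV (gtr0_norm Q0) exprSr invfM mulrA ler_pM2r ?invr_gt0 //.
apply: IH; [exact: words_shift|exact: words_shift|].
by apply: agree_shift; rewrite add1n.
Qed.

(** A difference of 1 in the first differing digit is compensated by the tails
up to 2 p.  For p = 0 this is monotonicity; in base 2 it needs the bound 1/2 on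
the tails, which ternary words in general violate. *)
Lemma val_diff_le m (p : R) a b : words tern a -> words tern b -> ltw sg_lex m a b ->
  `|val (shift m.+1 a)| <= 1 / 2 + p -> `|val (shift m.+1 b)| <= 1 / 2 + p ->
  val a - val b <= 2 * p / Q ^+ m.+1.
Proof.
elim: m a b => [|m IH] a b ta tb [ab lt] ha hb.
  rewrite (val_rec ta) (val_rec tb) expr1 -mulrBl ler_pM2r ?invr_gt0 //.
  rewrite !mul1r in lt; have : (a 0%N)%:~R + 1 <= (b 0%N)%:~R :> R.
    exact: intr_lt_succ.
  by move: ha hb; rewrite !ler_norml; lra.
rewrite (val_rec ta) (val_rec tb) ab // -mulrBl opprD addrACA subrr add0r.
rewrite exprSr invfM [X in _ <= X]mulrA ler_pM2r ?invr_gt0 //.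
apply: IH; [exact: words_shift|exact: words_shift| | |].
- by split => //; apply: agree_shift; rewrite add1n.
- by rewrite shift_shift add1n.
- by rewrite shift_shift add1n.
Qed.

Lemma val_mono_le a b : words tern a -> words tern b -> lew sg_lex a b ->
  (forall n, `|val (shift n a)| <= 1 / 2) ->
  (forall n, `|val (shift n b)| <= 1 / 2) -> val a <= val b.
Proof.
move=> ta tb [->//|[n lt]] ha hb; rewrite -subr_le0.
have := val_diff_le (p := 0) ta tb lt; rewrite addr0 mulr0 mul0r.
by apply; [apply: ha|apply: hb].
Qed.

Lemma val_tern_le_half a : (3 <= q)%N -> words tern a -> `|val a| <= 1 / 2.
Proof.
move=> q3 ta; apply: le_trans (val_bound ta) _.
have : 3 <= Q by rewrite ler_nat.
by move=> h; rewrite ler_pdivrMr //; lra.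
Qed.

(** The uniform bound 1/2 + 1/2^i improves to 1/2 + 1/2^(i+1): a dominated word
that starts with 0 has half the value of its tail, and one that starts with the
same letter as s differs from s from the second letter on only. *)
Lemma dominated_val_le_half s b : words tern s -> val s <= 1 / 2 ->
  words tern b -> tails_dominated s b -> tails_dominated s s -> `|val b| <= 1 / 2.
Proof.
move=> ts vs tb db ds.
suff bound i w : words tern w -> tails_dominated s w -> `|val w| <= 1 / 2 + 1 / 2 ^+ i.
  rewrite leNgt; apply/negP; rewrite -subr_gt0 => h.
  have [n] : exists n, 1 / 2 ^+ n < `|val b| - 1 / 2.
    have q12 : `|2^-1 : R| < 1 by rewrite gtr0_norm; lra.
    have /cvgrPdist_lt/(_ _ h)[n _ /(_ n (leqnn _))] := cvg_geometric (1 : R) q12.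
    rewrite /= sub0r normrN exprVn => lt; exists n.
    by apply: le_lt_trans lt; apply: ler_norm.
  by have := bound n b tb db; lra.
elim: i w => [|i IH] w tw dw.
  by rewrite expr0; have := val_le1 tw; lra.
have p0 : 0 < 1 / 2 ^+ i :> R by rewrite divr_gt0 // exprn_gt0.
have pS : 1 / 2 ^+ i.+1 = (1 / 2 ^+ i) / 2 :> R by rewrite exprSr invfM mulrA.
wlog w0 : w tw dw / lew sg_lex zerow w.
  move=> wl; have [e he E] := absw_sign w; have e0 := zerow_le_absw w; rewrite E in e0.
  rewrite -(norm_val_scalew he tw); apply: wl => //; first exact: words_scalew.
  exact: tails_dominated_scalew.
have tl n : `|val (shift n w)| <= 1 / 2 + 1 / 2 ^+ i.
  by apply: IH; [apply: words_shift|apply: tails_dominated_shift].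
have sl n : `|val (shift n s)| <= 1 / 2 + 1 / 2 ^+ i.
  by apply: IH; [apply: words_shift|apply: tails_dominated_shift].
have Qi : Q^-1 <= 1 / 2 by rewrite mul1r lef_pV2 // posrE.
have Qi0 : 0 < Q^-1 by rewrite invr_gt0.
have half (x y : R) : 0 <= y -> x <= y -> x / Q <= y / 2.
  move=> y0 xy; apply: (@le_trans _ _ (y / Q)); first by rewrite ler_pM2r.
  by rewrite ler_wpM2l // -[2^-1]mul1r.
have halfN (x y : R) : 0 <= y -> - y <= x -> - (y / 2) <= x / Q.
  by move=> y0 xy; rewrite lerNl -mulNr; apply: half => //; rewrite lerNl.
have w00 : 0 <= w 0%N.
  have := lew_le w0 (n := 0); rewrite !mul1r; apply; by move=> ?; rewrite ltn0.
have ws0 : w 0%N <= s 0%N.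
  have := dw 0%N 1 (or_introl erefl); rewrite scalew1 shift0 => h.
  have := lew_le h (n := 0); rewrite !mul1r; apply; by move=> ?; rewrite ltn0.
have s01 : s 0%N <= 1.
  by have := ts 0%N; rewrite !inE => /or3P[] /eqP ->.
have := tl 1%N; rewrite !ler_norml => /andP[tl1 tl2].
case: (ltgtP (w 0%N) 0) => [|wpos|wz]; first by rewrite ltNge w00.
  have w1 : w 0%N = 1 by move: (tw 0%N) wpos; rewrite !inE => /or3P[] /eqP ->.
  have s1 : s 0%N = 1 by apply/eqP; rewrite eq_le s01 -w1.
  have vw := val_rec tw; rewrite w1 in vw.
  apply/andP; split.
    rewrite vw pS; apply: le_trans (halfN _ (1 / 2 ^+ i) (ltW p0) _); last by lra.
    by lra.
  have := dw 0%N 1 (or_introl erefl); rewrite scalew1 shift0 => -[->|[n [ag lt]]].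
    by lra.
  case: n ag lt => [|n] ag lt; first by rewrite w1 s1 ltxx in lt.
  have := val_diff_le tw ts (conj ag lt) (tl _) (sl _).
  have Q4 : 4 <= Q ^+ n.+2.
    have Q1 : 1 <= Q by have := Q2; lra.
    have QQ : 4 <= Q * Q by have := Q2; nra.
    rewrite !exprS mulrA; apply: (le_trans QQ).
    by apply: ler_peMr; [exact/mulr_ge0/ltW/Q0/ltW/Q0|exact: exprn_ege1].
  have z4 : (Q ^+ n.+2)^-1 <= 4^-1 by rewrite lef_pV2 ?posrE ?exprn_gt0 //.
  have := ler_wpM2l (ltW p0) z4.
  by rewrite pS -[2 * _ / _]mulrA; lra.
have vw := val_rec tw; rewrite wz add0r in vw.
rewrite vw pS; apply/andP; split.
  by apply: le_trans (halfN _ (1 / 2 + 1 / 2 ^+ i) _ _); lra.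
by apply: le_trans (half _ (1 / 2 + 1 / 2 ^+ i) _ tl2) _; lra.
Qed.

Lemma dominated_val_le s b : words tern s -> tails_dominated s s -> val s <= 1 / 2 ->
  words tern b -> tails_dominated s b -> `|val b| <= val s.
Proof.
move=> ts ds vs tb db.
have half w n : words tern w -> tails_dominated s w -> `|val (shift n w)| <= 1 / 2.
  move=> tw dw; apply: (dominated_val_le_half ts) => //; first exact: words_shift.
  exact: tails_dominated_shift.
have up w : words tern w -> tails_dominated s w -> val w <= val s.
  move=> tw dw; apply: val_mono_le => //; try by move=> n; apply: half.
  by have := dw 0%N 1 (or_introl erefl); rewrite scalew1 shift0.
rewrite ler_norml up // andbT lerNl.
have sN : is_sign (-1) by right.
have := up _ (words_scalew sN tb) (tails_dominated_scalew sN db).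
by rewrite val_scalew // rmorphN1 mulN1r.
Qed.

End value.

(** * Distances to the nearest integer and their limits superior *)

Section distance.
Variable R : realType.
Implicit Types x y l : R.

Let dist_set x : set R := range (fun z : int => `|x - z%:~R|).

Let dist_set_lb x : has_lbound (dist_set x).
Proof. by exists 0 => _ [z _ <-]. Qed.

Let dist_set0 x : dist_set x !=set0.
Proof. by exists `|x - 0%:~R|; exists 0. Qed.

Lemma dist_int_le x (z : int) : dist_int x <= `|x - z%:~R|.
Proof. by apply: (ge_inf (dist_set_lb x)); exists z. Qed.

Lemma dist_int_ge0 x : 0 <= dist_int x.
Proof. by apply: lb_le_inf; [exact: dist_set0|move=> _ [z _ <-]]. Qed.

Lemma dist_int_norm x : dist_int x <= `|x|.
Proof. by have := dist_int_le x 0; rewrite subr0. Qed.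

Lemma dist_int_half x : `|x| <= 1 / 2 -> dist_int x = `|x|.
Proof.
move=> x2; apply/eqP; rewrite eq_le dist_int_norm /=.
apply: lb_le_inf; [exact: dist_set0|move=> _ [z _ <-]].
have [->|z0] := eqVneq z 0; first by rewrite subr0.
have z1 : 1 <= `|z%:~R : R|.
  by rewrite -intr_norm -[1]/(1%:~R) ler_int -gtz0_ge1 normr_gt0.
have := ler_normB (x - z%:~R) x.
by rewrite [x - _ - x]addrAC subrr add0r normrN; lra.
Qed.

Lemma dist_int_lip x y : dist_int x <= dist_int y + `|x - y|.
Proof.
rewrite -lerBlDr; apply: lb_le_inf; [exact: dist_set0|move=> _ [z _ <-]].
rewrite lerBlDr; apply: (le_trans (dist_int_le x z)).
by have := ler_normD (y - z%:~R) (x - y); rewrite addrC addrA subrK.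
Qed.

Lemma dist_intDz x (z : int) : dist_int (x + z%:~R) = dist_int x.
Proof.
suff h (u : R) (m : int) : dist_int (u + m%:~R) <= dist_int u.
  apply/eqP; rewrite eq_le h /= -{1}[x](addrK z%:~R) -mulrNz.
  exact: h.
apply: (@lb_le_inf _ (dist_set u)); [exact: dist_set0|move=> _ [k _ <-]].
have := dist_int_le (u + m%:~R) (k + m).
by rewrite intrD opprD addrACA subrr addr0.
Qed.

Section limsup.
Variables (u : R^nat) (C : R).
Hypothesis uC : forall n, `|u n| <= C.

Let bounded_u : bounded_fun u.
Proof.
exists C; split; first exact: num_real.
by move=> M CM n _; apply: le_trans (uC n) (ltW CM).
Qed.

Let sdrop_ub n : has_ubound (sdrop u n).
Proof. by exists C => _ [k _ <-]; apply: le_trans (ler_norm _) (uC k). Qed.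

Let sdrop0 n : sdrop u n !=set0.
Proof. by exists (u n), n => /=. Qed.

Let sups_ge n : u n <= sups u n.
Proof. by apply: (ub_le_sup (sdrop_ub n)); exists n => /=. Qed.

Let sups_lb : has_lbound (range (sups u)).
Proof.
exists (- C) => _ [n _ <-]; apply: le_trans (sups_ge n).
by have := uC n; rewrite ler_norml => /andP[].
Qed.

Let sups0 : range (sups u) !=set0.
Proof. by exists (sups u 0), 0%N. Qed.

Lemma limn_sup_eq l :
  (forall e, 0 < e -> exists N, forall n, (N <= n)%N -> u n <= l + e) ->
  (forall e N, 0 < e -> exists2 n, (N <= n)%N & l - e <= u n) ->
  limn_sup u = l.
Proof.
move=> up low; rewrite limn_supE //; apply/eqP; rewrite eq_le; apply/andP; split.
  apply/ler_addgt0Pr => e /up[N uN].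
  apply: (@le_trans _ _ (sups u N)); first by apply: (ge_inf sups_lb); exists N.
  by apply: ge_sup => // _ [k /= Nk <-]; apply: uN.
apply: lb_le_inf => // _ [N _ <-].
apply/ler_addgt0Pr => e e0; have [n Nn h] := low e N e0.
rewrite -lerBlDr; apply: (le_trans h).
by apply: (ub_le_sup (sdrop_ub N)); exists n.
Qed.

Lemma limn_sup_eventually_le l e : limn_sup u <= l -> 0 < e ->
  exists N, forall n, (N <= n)%N -> u n <= l + e.
Proof.
rewrite limn_supE // => ul e0.
have [_ [N _ <-] lt] := inf_adherent e0 (conj sups0 sups_lb).
exists N => n Nn; apply: (@le_trans _ _ (sups u N)).
  by apply: (ub_le_sup (sdrop_ub N)); exists n.
by apply: (le_trans (ltW lt)); rewrite lerD2r.
Qed.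

Lemma limn_sup_ge0 : (forall n, 0 <= u n) -> 0 <= limn_sup u.
Proof.
move=> u0; rewrite limn_supE //; apply: lb_le_inf => // _ [N _ <-].
exact: le_trans (u0 N) (sups_ge N).
Qed.

End limsup.

(** The half-open range [-1/2, 1/2) matters in base 3, where it excludes the
digits 2 and -2. *)
Definition signed_dist x : R := x - (Num.floor (x + 1 / 2))%:~R.

Lemma signed_dist_bounds x : - (1 / 2) <= signed_dist x < 1 / 2.
Proof.
have /andP[] := Num.Theory.floor_itv (x + 1 / 2).
by rewrite /signed_dist intrD; lra.
Qed.

Lemma dist_int_signed x : dist_int x = `|signed_dist x|.
Proof.
rewrite -[x in LHS](subrK (Num.floor (x + 1 / 2))%:~R) dist_intDz.
apply: dist_int_half; rewrite ler_norml; have := signed_dist_bounds x.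
by rewrite /signed_dist; lra.
Qed.

Lemma dist_int_le_half x : `|dist_int x| <= 1 / 2.
Proof.
rewrite dist_int_signed normr_id ler_norml.
by have := signed_dist_bounds x; lra.
Qed.

End distance.

(** * Limits superior of distances are the values of self-dominated words *)

(** The limit superior s of the words abs(a_n a_(n+1) ...) dominates its own
tails: its prefixes occur infinitely often, so a tail of s that exceeded s would
make infinitely many of these words exceed s. *)
Lemma tails_limsup a : words tern a ->
  exists s, [/\ words tern s, tails_dominated s s,
    forall k N, exists2 n, (N <= n)%N & agree k s (absw (shift n a)) &
    forall k, exists N, forall n i, (N <= n)%N -> (i < k)%N ->
      ~ ltw sg_lex i s (absw (shift n a))].
Proof.
move=> ta; pose B n := absw (shift n a).
have BE n : exists2 e, is_sign e & B n = scalew e (shift n a) by apply: absw_sign.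
have FB : nbhs (B @ \oo) (words tern).
  by exists 0%N => // n _; apply: (range_absw_tern ta); exists n.
have [s [ts freq no]] := filter_limsup sg_lex FB.
have {}freq k N : exists2 n, (N <= n)%N & agree k s (B n).
  apply: contrapT => h; apply: (freq k); exists N => // n /= Nn ag.
  by apply: h; exists n.
have {}no k : exists N, forall n i, (N <= n)%N -> (i < k)%N -> ~ ltw sg_lex i s (B n).
  elim: k => [|k [N IH]]; first by exists 0%N.
  have [M _ noM] := no k; exists (maxn N M) => n i; rewrite geq_max => /andP[Nn Mn].
  by rewrite ltnS leq_eqVlt => /orP[/eqP->|]; [apply: noM|apply: IH].
exists s; split => // k e he.
case: (lew_total sg_lexP (scalew e (shift k s)) s) => // -[i lt].
have [N noN] := no i.+1; have [n Nn sB] := freq (k + i.+1)%N N.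
have [d hd BnE] := BE n.
have := ltw_agreer (agree_scalew e (agree_shift sB)) lt.
rewrite BnE shift_scalew shift_shift scalewA => lt'.
have noNk j : (j < i.+1)%N -> ~ ltw sg_lex j s (B (n + k)%N).
  by apply: noN; apply: leq_trans Nn (leq_addr _ _).
have := @absw_ge (shift (n + k) a) _ (is_signM he hd).
case=> [E|[j gt]]; first by case: (noNk i) => //; rewrite /B -E.
by case: (noNk (minn i j)); [rewrite ltnS geq_minl|apply: ltw_trans lt' gt].
Qed.

Section realisation.
Variables (R : realType) (q : nat).
Hypothesis q2 : (2 <= q)%N.
Local Notation Q := (q%:R : R).
Local Notation val := (pi_base Q).

Let Q0 : 0 < Q := base_gt0 R q2.

Lemma Mabs_lex_val_le s b : Mabs_lex s -> val s <= 1 / 2 ->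
  words tern b -> tails_dominated s b -> `|val b| <= val s.
Proof. by move=> /Mabs_lexP[ts ds] vs; apply: dominated_val_le. Qed.

Lemma power_val_int a n : words tern a ->
  exists z : int, val a * Q ^+ n = z%:~R + val (shift n a).
Proof.
move=> ta; elim: n => [|n [z IH]].
  by exists 0; rewrite expr0 mulr1 shift0 add0r.
exists (z * q%:Z + a n).
rewrite exprSr mulrA IH (val_shift_rec _ q2 n ta) mulrDl mulfVK ?gt_eqF //.
by rewrite intrD intrM -addrA.
Qed.

Lemma dist_power_val a n : words tern a ->
  dist_int (val a * Q ^+ n) = dist_int (val (shift n a)).
Proof. by move=> /power_val_int -/(_ n)[z ->]; rewrite addrC dist_intDz. Qed.

(** The real number is the value of the word of [limit_tails_dominated]. *)
Lemma Mabs_lex_Ltilde s : Mabs_lex s -> val s <= 1 / 2 -> Ltilde Q (val s).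
Proof.
move=> Ms vs; have /Mabs_lexP[ts ds] := Ms.
have [a [ta dom rec]] := limit_tails_dominated ts ds.
have vs0 : 0 <= val s.
  by apply: le_trans (normr_ge0 _) (Mabs_lex_val_le Ms vs ts ds).
exists (val a) => //; apply: (@limn_sup_eq _ _ (1 / 2)).
- by move=> n; apply: dist_int_le_half.
- move=> e e0; have [I hI] := small_power q2 2 e0.
  have [T hT] := dom I; exists T => t Tt; rewrite dist_power_val //.
  have [b [tb db ab]] := hT t Tt.
  have := Mabs_lex_val_le Ms vs tb db.
  have := val_agree R q2 (words_shift _ ta) tb ab.
  have := hI I (leqnn I).
  have := dist_int_norm (val (shift t a)).
  have := ler_normD (val (shift t a) - val b) (val b).
  by rewrite subrK; lra.
- move=> e N e0; have [I hI] := small_power q2 2 e0.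
  have [t [d [Tt hd ag]]] := rec I N; exists t => //; rewrite dist_power_val //.
  have := val_agree R q2 (words_shift _ ta) (words_scalew hd ts) ag.
  have nv : `|val (scalew d s)| = val s by rewrite norm_val_scalew // ger0_norm.
  have := dist_int_lip (val (scalew d s)) (val (shift t a)).
  rewrite dist_int_half nv // distrC.
  by have := hI I (leqnn I); lra.
Qed.

(** If z_n is the integer nearest to x q^n, then the digit of index n is
z_(n+1) - q z_n, and x q^n - z_n is the value of the word of the digits from the
index n on. *)
Let eps (x : R) (n : nat) : R := signed_dist (x * Q ^+ n).
Let near_digit (x : R) (n : nat) : int :=
  Num.floor (x * Q ^+ n.+1 + 1 / 2) - q%:Z * Num.floor (x * Q ^+ n + 1 / 2).

Let near_digitE x n : (near_digit x n)%:~R = Q * eps x n - eps x n.+1.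
Proof.
rewrite /near_digit /eps /signed_dist intrB intrM exprS.
by ring.
Qed.

Lemma lt2_tern (z : int) : `|z%:~R : R| < 2 -> z \in tern.
Proof.
rewrite -intr_norm -[2]/(2%:~R) ltr_int !inE.
by case: z => [[|[|[|n]]]|[|n]].
Qed.

(** Once the digits are ternary, all tails have values in [-1/2, 1/2], where the
value is monotone.  Hence the limit superior of the values is the value of the
limit superior of the words. *)
Lemma Ltilde_Mabs_lex x :
  (exists N, forall n, (N <= n)%N -> `|Q * eps x n - eps x n.+1| < 2) ->
  exists s, [/\ Mabs_lex s, val s <= 1 / 2 &
    limn_sup (fun n => dist_int (x * Q ^+ n)) = val s].
Proof.
move=> [N small]; pose a n := near_digit x (N + n).
have ta : words tern a.
  by move=> n; apply: lt2_tern; rewrite near_digitE; apply: small; apply: leq_addr.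
have eps2 n : `|eps x n| <= 1 / 2.
  by have := signed_dist_bounds (x * Q ^+ n); rewrite ler_norml -/(eps x n); lra.
have epsE n : eps x (N + n) = val (shift n a).
  apply: (val_unique q2 (C := 1 / 2) ta (e := fun n => eps x (N + n))) => // m.
  by rewrite /a near_digitE addnS subrK mulrAC mulfV ?mul1r // gt_eqF.
have [s [ts ds freq no]] := tails_limsup ta.
have Ms : Mabs_lex s by apply/Mabs_lexP.
pose B n := absw (shift n a).
have BE n : exists2 e, is_sign e & B n = scalew e (shift n a) by apply: absw_sign.
have tB n : words tern (B n).
  by have [e he ->] := BE n; apply: words_scalew => //; apply: words_shift.
have tlB n k : `|val (shift k (B n))| <= 1 / 2.
  have [e he ->] := BE n; rewrite shift_scalew norm_val_scalew //.
    by rewrite shift_shift -epsE.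
  by do 2 apply: words_shift.
have tls k : `|val (shift k s)| <= 1 / 2.
  apply: (@le_small_power R q q2 _ _ 2) => m.
  have [n _ ag] := freq (k + m)%N 0%N.
  have := val_agree R q2 (words_shift _ ts) (words_shift _ (tB n)) (agree_shift ag).
  have := ler_normD (val (shift k s) - val (shift k (B n))) (val (shift k (B n))).
  by have := tlB n k; rewrite subrK; lra.
have B0 n : 0 <= val (B n).
  rewrite -(val_zerow R q2); apply: val_mono_le => //.
  - exact: zerow_le_absw.
  - by move=> k; rewrite (_ : shift k zerow = zerow) // val_zerow // normr0; lra.
have distE n : dist_int (x * Q ^+ (N + n)) = val (B n).
  rewrite dist_int_signed -/(eps x (N + n)) epsE -(ger0_norm (B0 n)).
  have [e he ->] := BE n; rewrite [RHS]norm_val_scalew //; exact: words_shift.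
exists s; split => //.
  by have := tls 0%N; rewrite shift0; apply: le_trans; apply: ler_norm.
apply: (@limn_sup_eq _ _ (1 / 2)) => [n|e e0|e M e0].
- exact: dist_int_le_half.
- have [k hk] := small_power q2 2 e0; have [M noM] := no k.
  exists (N + M)%N => n NMn; rewrite -(@subnKC N n) ?distE; last by lia.
  set m := (n - N)%N; have Mm : (M <= m)%N by rewrite /m; lia.
  have [le|gt] := lew_total sg_lexP (B m) s.
    by have := val_mono_le q2 (tB m) ts le (tlB m) tls; lra.
  have [i gti] := gt; have [ki|ik] := leqP k i; last by case: (noM m i Mm ik).
  have := val_agree R q2 (tB m) ts (agree_sym (agree_le ki gti.1)).
  have := hk k (leqnn k); have := ler_norm (val (B m) - val s); lra.
- have [k hk] := small_power q2 2 e0; have [m Mm ag] := freq k M.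
  exists (N + m)%N; first by lia.
  rewrite distE; have := val_agree R q2 ts (tB m) ag.
  by have := hk k (leqnn k); have := ler_norm (val s - val (B m)); lra.
Qed.

Lemma Ltilde_le3 y : (q <= 3)%N -> Ltilde Q y ->
  exists2 s, Mabs_lex s & val s = y /\ y <= 1 / 2.
Proof.
move=> q3 [x _ <-]; have [|s [Ms vs ->]] := @Ltilde_Mabs_lex x; last by exists s.
exists 0%N => n _.
have := signed_dist_bounds (x * Q ^+ n); have := signed_dist_bounds (x * Q ^+ n.+1).
rewrite -!/(eps _ _) ltr_norml.
have [->|->] : q = 2%N \/ q = 3%N by lia.
all: by lra.
Qed.

Lemma Ltilde_ge4 y : (4 <= q)%N -> Ltilde Q y -> y <= 1 / (Q - 1) ->
  exists2 s, Mabs_lex s & val s = y.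
Proof.
move=> q4 [x _ <-] yle; have [|s [Ms vs ->]] := @Ltilde_Mabs_lex x; last by exists s.
have Q4 : 4 <= Q by rewrite ler_nat.
(* Eventually the digits are at most (q + 1) (1 / (q - 1) + e / 2) in absolute
   value; this is less than 2 as e is what separates 1 / (q - 1) from
   2 / (q + 1). *)
pose e := 2 / (Q + 1) - 1 / (Q - 1).
have e0 : 0 < e / 2.
  have -> : e = (Q - 3) / ((Q + 1) * (Q - 1)) by rewrite /e; field; lra.
  by rewrite !divr_gt0 // ?mulr_gt0; lra.
have := @limn_sup_eventually_le _ _ (1 / 2) (fun n => dist_int_le_half _) _ _ yle e0.
move=> [N hN]; exists N => n Nn.
have := hN n Nn; have := hN n.+1 (leqW Nn).
rewrite !dist_int_signed -!/(eps _ _) => h1 h2.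
have h3 : 1 / (Q - 1) + e / 2 < 2 / (Q + 1) by move: e0; rewrite /e; lra.
have Q1 : 0 < Q + 1 by lra.
apply: (le_lt_trans (ler_normB _ _)); rewrite normrM (gtr0_norm Q0).
have -> : 2 = Q * (2 / (Q + 1)) + 2 / (Q + 1) by field; lra.
apply: ltrD; last exact: le_lt_trans h3.
by rewrite ltr_pM2l //; apply: le_lt_trans h3.
Qed.

Lemma Ltilde_ge0 y : Ltilde Q y -> 0 <= y.
Proof.
move=> [x _ <-]; apply: (@limn_sup_ge0 _ _ (1 / 2)) => n.
  exact: dist_int_le_half.
exact: dist_int_ge0.
Qed.

(** The point 2 / (q + 1) is mapped to its opposite modulo 1 by multiplication
by q. *)
Lemma Ltilde_two_div : (4 <= q)%N -> Ltilde Q (2 / (Q + 1)).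
Proof.
move=> q4; have Q4 : 4 <= Q by rewrite ler_nat.
have Q1 : 0 < Q + 1 by lra.
have z0 : 0 < 2 / (Q + 1) by rewrite divr_gt0.
have z1 : `|2 / (Q + 1)| <= 1 / 2 by rewrite gtr0_norm // ler_pdivrMr //; lra.
have pow n : exists z : int, 2 / (Q + 1) * Q ^+ n = (-1) ^+ n * (2 / (Q + 1)) + z%:~R.
  elim: n => [|n [z IH]]; first by exists 0; rewrite !expr0 mulr1 mul1r addr0.
  exists (z * q%:Z + 2 * (-1) ^+ n).
  rewrite exprSr mulrA IH exprS intrD !intrM rmorphXn rmorphN1 /=.
  by field; lra.
exists (2 / (Q + 1)) => //.
have E n : dist_int (2 / (Q + 1) * Q ^+ n) = 2 / (Q + 1).
  have [z ->] := pow n; rewrite dist_intDz.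
  have nE : `|(-1) ^+ n * (2 / (Q + 1))| = 2 / (Q + 1).
    by rewrite normrM normrX normrN normr1 expr1n mul1r gtr0_norm.
  by rewrite dist_int_half nE // -(gtr0_norm z0).
apply: (@limn_sup_eq _ _ (1 / 2)) => [n|e e0|e N e0].
- exact: dist_int_le_half.
- by exists 0%N => n _; rewrite E; lra.
- by exists N => //; rewrite E; lra.
Qed.

End realisation.

(** * The substitutions on infinite words *)

Definition wcat (b : seq int) (w : word) : word :=
  fun n => if (n < size b)%N then nth 0 b n else w (n - size b)%N.

Lemma shift_wcat b w : shift (size b) (wcat b w) = w.
Proof. by apply/funext => k; rewrite /Defs.shift /wcat ltnNge leq_addr addKn. Qed.

Lemma agree_wcat b n w w' : agree n w w' -> agree (size b + n) (wcat b w) (wcat b w').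
Proof. by move=> ag k kn; rewrite /wcat; case: ltnP => // bk; apply: ag; lia. Qed.

Lemma wcatP b w w' : agree (size b) w (nth 0 b) -> shift (size b) w = w' -> w = wcat b w'.
Proof.
move=> ag <-; apply/funext => k; rewrite /wcat; case: ltnP => [/ag //|bk].
by rewrite /Defs.shift subnKC.
Qed.

Definition tau : word -> word := extend tau02.
Definition rho : word -> word := extend rho2.

Definition tau_block (x : int) : seq int := if x == 0 then [:: 1] else [:: 1; 0; 0].
Definition rho_block (x : int) : seq int := if x == 0 then [:: 1] else [:: 1; 0].

Lemma mkseq_cons (a : word) n : mkseq a n.+1 = a 0%N :: mkseq (shift 1 a) n.
Proof. by rewrite /mkseq /= (iotaDl 1 0) -map_comp. Qed.

Lemma prefix_tau02 u v : prefix (tau02 u) (tau02 (u ++ v)).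
Proof. exact: (prefix_iter_tau02 1). Qed.

Lemma size_tau02 u : (size u <= size (tau02 u))%N.
Proof. exact: (size_iter_tau02 1). Qed.

Lemma rho2_cons x w : rho2 (x :: w) = rho_block x ++ map -%R (rho2 w).
Proof.
elim/last_ind: w => [|w y IH]; first by rewrite -[[:: x]]/(rcons [::] x) rho2_rcons cats0.
rewrite -rcons_cons !rho2_rcons IH map_cat catA /=; congr (_ ++ _).
by case: (odd _); case: (y == 0); rewrite /= ?opprK ?oppr0.
Qed.

Lemma nth_map_opp (s : seq int) i : nth 0 (map -%R s) i = - nth 0 s i.
Proof.
case: (ltnP i (size s)) => h; first by rewrite (nth_map 0).
by rewrite !nth_default ?oppr0 ?size_map.
Qed.

Lemma tau_unfold a : tau a = wcat (tau_block (a 0%N)) (tau (shift 1 a)).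
Proof.
have E n : tau02 (mkseq a n.+1) = tau_block (a 0%N) ++ tau02 (mkseq (shift 1 a) n).
  by rewrite mkseq_cons /tau02 /=.
apply: wcatP.
  by move=> k kb; rewrite /tau /extend E nth_cat kb.
apply/funext => k; rewrite /Defs.shift {1}/tau /extend E nth_cat ltnNge leq_addr /= addKn.
apply/esym/extendE; [exact: prefix_tau02|exact: size_tau02|].
apply: leq_trans (size_tau02 _); rewrite size_mkseq.
by rewrite /tau_block; case: (_ == _) => /=; lia.
Qed.

Lemma rho_unfold a :
  rho a = wcat (rho_block (a 0%N)) (scalew (-1) (rho (shift 1 a))).
Proof.
have E n : rho2 (mkseq a n.+1) =
    rho_block (a 0%N) ++ map -%R (rho2 (mkseq (shift 1 a) n)).
  by rewrite mkseq_cons rho2_cons.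
apply: wcatP.
  by move=> k kb; rewrite /rho /extend E nth_cat kb.
apply/funext => k; rewrite /Defs.shift {1}/rho /extend E nth_cat ltnNge leq_addr /= addKn.
rewrite nth_map_opp /scalew mulN1r; congr (- _).
apply/esym/extendE; [exact: prefix_rho2|exact: size_rho2|].
apply: leq_trans (size_rho2 _); rewrite size_mkseq.
by rewrite /rho_block; case: (_ == _) => /=; lia.
Qed.

Lemma extend_iter_tau02 n a : extend (iter n tau02) a = iter n tau a.
Proof.
elim: n => [|n IH].
  by apply/funext => k; rewrite /extend /= nth_mkseq.
rewrite iterS -IH; apply/funext => k; rewrite /tau {1}/extend /=.
set g := iter n tau02 (mkseq a k.+1).
have sg : (k < size g)%N.
  by apply: leq_trans (size_iter_tau02 _ _); rewrite size_mkseq.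
have -> : g = mkseq (extend (iter n tau02) a) k.+1 ++ drop k.+1 g.
  rewrite -{1}(cat_take_drop k.+1 g); congr (_ ++ _).
  apply: (@eq_from_nth _ 0); rewrite size_takel ?size_mkseq // => i ik.
  rewrite nth_take // nth_mkseq //; apply/esym/extendE.
  - exact: prefix_iter_tau02.
  - exact: size_iter_tau02.
  - exact: leq_trans ik sg.
have /prefixP[t ->] := prefix_tau02 (mkseq (extend (iter n tau02) a) k.+1) (drop k.+1 g).
rewrite nth_cat; have := size_tau02 (mkseq (extend (iter n tau02) a) k.+1).
by rewrite size_mkseq => ->.
Qed.

Lemma words_extend A f a : 0 \in A -> (forall w, all [in A] (f w)) -> words A (extend f a).
Proof.
move=> A0 Af n; rewrite /extend; set w := f _.
case: (ltnP n (size w)) => nw; last by rewrite nth_default.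
exact/(allP (Af _))/mem_nth.
Qed.

Lemma words_tau a : words bin (tau a).
Proof.
apply: words_extend => // w; elim: w => //= x w IH.
by rewrite /tau02 /= all_cat; apply/andP; split; [case: (x == 0)|].
Qed.

Lemma words_rho a : words tern (rho a).
Proof.
apply: words_extend => // w; elim/last_ind: w => // w x IH.
by rewrite rho2_rcons all_cat IH; case: (odd _); case: (x == 0).
Qed.

Lemma tau_head a : tau a 0%N = 1.
Proof. by rewrite tau_unfold /tau_block; case: (_ == _). Qed.

Lemma rho_head a : rho a 0%N = 1.
Proof. by rewrite rho_unfold /rho_block; case: (_ == _). Qed.

(** One letter is gained, because every image starts with 1. *)
Lemma tau_agree n u v : agree n u v -> agree n.+1 (tau u) (tau v).
Proof.
elim: n u v => [|n IH] u v uv.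
  by case=> // _; rewrite !tau_head.
rewrite (tau_unfold u) (tau_unfold v) uv //.
have uv' : agree n (shift 1 u) (shift 1 v) by apply: agree_shift; rewrite add1n.
apply: agree_le (agree_wcat (IH _ _ uv')).
by rewrite /tau_block; case: (_ == _) => /=; lia.
Qed.

Lemma rho_agree n u v : agree n u v -> agree n (rho u) (rho v).
Proof.
elim: n u v => [|n IH] u v uv //.
rewrite (rho_unfold u) (rho_unfold v) uv //.
have uv' : agree n (shift 1 u) (shift 1 v) by apply: agree_shift; rewrite add1n.
apply: agree_le (agree_wcat (agree_scalew _ (IH _ _ uv'))).
by rewrite /rho_block; case: (_ == _) => /=; lia.
Qed.

Lemma sg_altD m n : sg_alt (m + n) = sg_alt m * sg_alt n.
Proof. by rewrite /sg_alt exprD. Qed.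

Lemma sg_alt_odd m : odd m -> sg_alt m = -1.
Proof. by move=> om; rewrite /sg_alt -signr_odd om expr1. Qed.

Lemma ltw_alt_odd l m a b : odd l -> agree l a b ->
  ltw sg_alt m (shift l b) (shift l a) -> ltw sg_alt (l + m) a b.
Proof.
move=> ol ab [h lt]; split; first exact/agree_glue/agree_sym/h.
by move: lt; rewrite /Defs.shift sg_altD (sg_alt_odd ol) !mulN1r !mulNr; lia.
Qed.

Lemma ltw_alt_tail m a b : ltw sg_alt m.+1 a b -> ltw sg_alt m (shift 1 b) (shift 1 a).
Proof.
move=> [ab lt]; split.
  by apply: agree_shift; rewrite add1n; apply: agree_sym.
by move: lt; rewrite -add1n sg_altD (@sg_alt_odd 1) // /Defs.shift !mulN1r !mulNr; lia.
Qed.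

Lemma ltw_alt_head u v : words bin u -> words bin v ->
  ltw sg_alt 0 u v -> u 0%N = 0 /\ v 0%N = 1.
Proof.
move=> bu bv [_]; rewrite /sg_alt expr0 !mul1r.
by have := bu 0%N; have := bv 0%N; rewrite !inE => /orP[] /eqP -> /orP[] /eqP ->.
Qed.

(** Both blocks 1 and 100 have odd length, so tau preserves the parity of
positions, hence the alternating order. *)
Lemma tau_mono n u v : words bin u -> words bin v -> ltw sg_alt n u v ->
  exists m, ltw sg_alt m (tau u) (tau v).
Proof.
elim: n u v => [|n IH] u v bu bv uv.
  have [u0 v0] := ltw_alt_head bu bv uv.
  exists 1%N; split; first by case=> // _; rewrite !tau_head.
  by rewrite (tau_unfold u) (tau_unfold v) u0 v0 /wcat /= tau_head.
have [m IHm] := IH _ _ (words_shift 1 bv) (words_shift 1 bu) (ltw_alt_tail uv).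
have uv0 : u 0%N = v 0%N by apply: uv.1.
exists (size (tau_block (v 0%N)) + m)%N; rewrite (tau_unfold u) (tau_unfold v) uv0.
apply: ltw_alt_odd.
- by rewrite /tau_block; case: (_ == _).
- by move=> k kb; rewrite /wcat kb.
- by rewrite !shift_wcat.
Qed.

Lemma ltw_lex_opp m a b : ltw sg_lex m a b -> ltw sg_lex m (scalew (-1) b) (scalew (-1) a).
Proof.
by move=> [ab lt]; split; [apply/agree_scalew/agree_sym|rewrite /scalew !mul1r in lt *; lia].
Qed.

(** The sign changes with every letter, and so does the direction of the
alternating order. *)
Lemma rho_mono n u v : words bin u -> words bin v -> ltw sg_alt n u v ->
  exists m, ltw sg_lex m (rho u) (rho v).
Proof.
elim: n u v => [|n IH] u v bu bv uv.
  have [u0 v0] := ltw_alt_head bu bv uv.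
  exists 1%N; split; first by case=> // _; rewrite !rho_head.
  by rewrite (rho_unfold u) (rho_unfold v) u0 v0 /wcat /= /scalew rho_head.
have [m IHm] := IH _ _ (words_shift 1 bv) (words_shift 1 bu) (ltw_alt_tail uv).
have uv0 : u 0%N = v 0%N by apply: uv.1.
exists (size (rho_block (v 0%N)) + m)%N; rewrite (rho_unfold u) (rho_unfold v) uv0.
apply: ltw_shift_lex; first by move=> k kb; rewrite /wcat kb.
by rewrite !shift_wcat; apply: ltw_lex_opp.
Qed.

Lemma lew_mono (f : word -> word) sg u v : words bin u -> words bin v ->
  (forall n, ltw sg_alt n u v -> exists m, ltw sg m (f u) (f v)) ->
  lew sg_alt u v -> lew sg (f u) (f v).
Proof. by move=> bu bv mono [->|[n /mono[m h]]]; [left|right; exists m]. Qed.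

(** Tails of an image that are not images of tails start inside a block, hence
with 0; they are smaller than any word that starts with 1. *)
Lemma shift_tau k u : (exists j, shift k (tau u) = tau (shift j u)) \/ tau u k = 0.
Proof.
elim/ltn_ind: k u => k IH u.
case: (posnP k) => [->|k0]; first by left; exists 0%N; rewrite !shift0.
case: (ltnP k (size (tau_block (u 0%N)))) => kb.
  right; rewrite tau_unfold /wcat kb; move: kb; rewrite /tau_block.
  by case: (_ == _); case: k k0 {IH} => [|[|[|k]]].
have E : shift k (tau u) = shift (k - size (tau_block (u 0%N))) (tau (shift 1 u)).
  by rewrite -{1}(subnKC kb) -shift_shift tau_unfold shift_wcat.
have [|[j Ej]|z] := IH (k - size (tau_block (u 0%N)))%N _ (shift 1 u).
- by move: kb; rewrite /tau_block; case: (_ == _) => /=; lia.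
- by left; exists (1 + j)%N; rewrite E Ej shift_shift.
- by right; rewrite -(addn0 k) -[LHS]/(shift k (tau u) 0%N) E /Defs.shift addn0.
Qed.

Lemma tau_shift j u : exists k, tau (shift j u) = shift k (tau u).
Proof.
elim: j u => [|j IH] u; first by exists 0%N; rewrite !shift0.
have [k E] := IH (shift 1 u); exists (size (tau_block (u 0%N)) + k)%N.
by rewrite -shift_shift [tau u]tau_unfold shift_wcat -E shift_shift.
Qed.

Lemma shift_rho k u :
  (exists j e, is_sign e /\ shift k (rho u) = scalew e (rho (shift j u))) \/ rho u k = 0.
Proof.
elim/ltn_ind: k u => k IH u.
case: (posnP k) => [->|k0].
  by left; exists 0%N, 1; split; [left|rewrite scalew1 !shift0].
case: (ltnP k (size (rho_block (u 0%N)))) => kb.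
  right; rewrite rho_unfold /wcat kb; move: kb; rewrite /rho_block.
  by case: (_ == _); case: k k0 {IH} => [|[|k]].
have E : shift k (rho u) =
    scalew (-1) (shift (k - size (rho_block (u 0%N))) (rho (shift 1 u))).
  by rewrite -{1}(subnKC kb) -shift_shift rho_unfold shift_wcat shift_scalew.
have [|[j [e [he Ej]]]|z] := IH (k - size (rho_block (u 0%N)))%N _ (shift 1 u).
- by move: kb; rewrite /rho_block; case: (_ == _) => /=; lia.
- left; exists (1 + j)%N, (-1 * e); split; first by apply: is_signM => //; right.
  by rewrite E Ej scalewA shift_shift.
- right; rewrite -(addn0 k) -[LHS]/(shift k (rho u) 0%N) E /scalew /Defs.shift addn0 z.
  by rewrite mulr0.
Qed.

Lemma rho_shift j u :
  exists k e, is_sign e /\ rho (shift j u) = scalew e (shift k (rho u)).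
Proof.
elim: j u => [|j IH] u.
  by exists 0%N, 1; split; [left|rewrite scalew1 !shift0].
have [k [e [he E]]] := IH (shift 1 u).
exists (size (rho_block (u 0%N)) + k)%N, (e * -1); split.
  by apply: is_signM => //; right.
rewrite -shift_shift [rho u]rho_unfold shift_wcat shift_scalew scalewA.
by rewrite -mulrA mulrNN !mulr1 -E shift_shift.
Qed.

Lemma tau_M_alt u : M_alt u -> M_alt (tau u).
Proof.
move=> /M_altP[bu du]; apply/M_altP; split; first exact: words_tau.
move=> k; have [[j ->]|z] := shift_tau k u.
  apply: (lew_mono (words_shift j bu) bu _ (du j)) => n.
  exact: tau_mono (words_shift j bu) bu.
apply: (@ltw_lew _ 0); split => //.
by rewrite /Defs.shift addn0 z tau_head.
Qed.

Lemma M_alt_tau u : words bin u -> M_alt (tau u) -> M_alt u.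
Proof.
move=> bu /M_altP[_ d]; apply/M_altP; split => // j.
case: (lew_total sg_altP (shift j u) u) => // -[n].
move=> /(tau_mono bu (words_shift j bu))[m]; have [k ->] := tau_shift j u.
by move/(lew_ltw_irr (d k)).
Qed.

Lemma rho_Mabs_lex u : M_alt u -> Mabs_lex (rho u).
Proof.
move=> /M_altP[bu du]; apply/Mabs_lexP; split; first exact: words_rho.
move=> k e he; have [[j [d [hd ->]]]|z] := shift_rho k u; last first.
  apply: (@ltw_lew _ 0); split => //.
  by rewrite /scalew /Defs.shift addn0 z rho_head mulr0.
rewrite scalewA; case: (is_signM he hd) => ->.
  rewrite scalew1; apply: (lew_mono (words_shift j bu) bu _ (du j)) => n.
  exact: rho_mono (words_shift j bu) bu.
by apply: (@ltw_lew _ 0); split => //; rewrite /scalew !rho_head.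
Qed.

Lemma M_alt_rho u : words bin u -> Mabs_lex (rho u) -> M_alt u.
Proof.
move=> bu /Mabs_lexP[_ d]; apply/M_altP; split => // j.
case: (lew_total sg_altP (shift j u) u) => // -[n].
move=> /(rho_mono bu (words_shift j bu))[m]; have [k [e [he ->]]] := rho_shift j u.
by move/(lew_ltw_irr (d k e he)).
Qed.

(** The preimage collects the letters whose blocks are peeled off one after the
other.  The guard condition on K turns agreement of depth n of all tails into
agreement of depth n.+1, hence into equality. *)
Lemma desubstitution (f : word -> word) (K : int -> word -> word) (P : word -> Prop) :
  (forall u, f u = K (u 0%N) (f (shift 1 u))) ->
  (forall x n w w', agree n w w' -> agree n.+1 (K x w) (K x w')) ->
  (forall w, P w -> exists x w', [/\ x \in bin, P w' & w = K x w']) ->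
  forall w, P w -> exists2 u, words bin u & w = f u.
Proof.
move=> fE Kag peel w Pw.
have /choice[g gP] : forall w, exists xw : int * word,
    P w -> [/\ xw.1 \in bin, P xw.2 & w = K xw.1 xw.2].
  move=> v; have [Pv|nPv] := pselect (P v); last by exists (0, v).
  by have [x [v' h]] := peel v Pv; exists (x, v').
pose W i := iter i (fun v => (g v).2) w.
have PW i : P (W i) by elim: i => //= i /gP[].
pose u i := (g (W i)).1.
exists u; first by move=> i; have [] := gP _ (PW i).
apply: agree_eq => n; rewrite -(shift0 u) -[w]/(W 0%N).
elim: n 0%N => // n IH i; rewrite fE.
have [_ _ ->] := gP _ (PW i).
rewrite -[(g (W i)).2]/(W i.+1) -[(g (W i)).1]/(u i) shift_shift addn1.
by rewrite /Defs.shift addn0; apply: Kag; apply: IH.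
Qed.

(** * The fixed point of the substitution *)

Lemma iter_tau_agree n u v : agree n (iter n tau u) (iter n tau v).
Proof. by elim: n => // n IH; rewrite !iterS; apply: tau_agree. Qed.

(** The diagonal of the iterates: the n-th iterate determines n letters. *)
Definition malt : word := fun k => iter k.+1 tau zerow k.

Lemma malt_agree n m : (n <= m)%N -> agree n malt (iter m tau zerow).
Proof.
move=> nm k kn; rewrite /malt -(@subnKC k.+1 m) ?iterD; last exact: leq_trans nm.
exact: iter_tau_agree.
Qed.

Lemma tau_malt : tau malt = malt.
Proof.
apply: agree_eq => n; apply: agree_trans (agree_sym (malt_agree (leqnSn n))).
exact/(agree_le (leqnSn n))/tau_agree/malt_agree.
Qed.

Lemma words_malt : words bin malt.
Proof. by rewrite -tau_malt; apply: words_tau. Qed.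

Lemma malt_prefix : [/\ malt 0%N = 1, malt 1%N = 0, malt 2%N = 0 & malt 3%N = 1].
Proof.
have m0 : malt 0%N = 1 by rewrite -tau_malt tau_head.
have E : malt = wcat [:: 1; 0; 0] (tau (shift 1 malt)).
  by rewrite -{1}tau_malt tau_unfold m0.
by split=> //; rewrite E /wcat //= tau_head.
Qed.

Lemma zerow_M_alt : M_alt zerow.
Proof. by apply/M_altP; split=> [n|k]; last by left. Qed.

Lemma iter_tau_M_alt n : M_alt (iter n tau zerow).
Proof. by elim: n => [|n IH]; [exact: zerow_M_alt|exact: tau_M_alt]. Qed.

Lemma words_iter_tau n : words bin (iter n tau zerow).
Proof. by have /M_altP[] := iter_tau_M_alt n. Qed.

Lemma iter_tau_lt_malt n : exists m, ltw sg_alt m (iter n tau zerow) malt.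
Proof.
elim: n => [|n [m IH]]; first by exists 0%N; split => //; rewrite -tau_malt tau_head.
rewrite -tau_malt iterS.
exact: tau_mono (words_iter_tau n) words_malt IH.
Qed.

Lemma bin01 (x : int) : x \in bin -> x = 0 \/ x = 1.
Proof. by rewrite !inE => /orP[] /eqP; [left|right]. Qed.

Lemma tern_cases (x : int) : x \in tern -> [\/ x = -1, x = 0 | x = 1].
Proof. by rewrite !inE => /or3P[] /eqP; [constructor 1|constructor 2|constructor 3]. Qed.

(** The fixed point starts with 1001, so a word at most [malt] that starts with 1
starts with 11 or with 1001. *)
Lemma desubst_tau t : words bin t -> t 0%N = 1 ->
  (forall k, t k = 1 -> lew sg_alt (shift k t) malt) ->
  exists2 u, words bin u & t = tau u.
Proof.
move=> bt t0 below.
pose P w := exists2 k, w = shift k t & w 0%N = 1.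
apply: (@desubstitution tau (fun x => wcat (tau_block x)) P); last by exists 0%N; rewrite ?shift0.
- exact: tau_unfold.
- move=> x n w w' ag; apply: agree_le (agree_wcat ag).
  by rewrite /tau_block; case: (_ == _) => /=; lia.
move=> _ [k -> tk]; rewrite /Defs.shift addn0 in tk.
have [m0 m1 m2 m3] := malt_prefix.
have le := below k tk.
have ag1 : agree 1 (shift k t) malt by case=> // _; rewrite /Defs.shift addn0 tk m0.
case: (bin01 (bt (k + 1)%N)) => t1; last first.
  exists 0, (shift 1 (shift k t)); split => //.
    by exists (k + 1)%N; rewrite ?shift_shift // /Defs.shift addn0.
  by apply: wcatP => // -[|//] _; rewrite /Defs.shift addn0 tk.
have ag2 : agree 2 (shift k t) malt.
  by case=> [|[|//]] _; rewrite /Defs.shift ?addn0 ?tk ?m0 // t1 m1.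
have t2 : t (k + 2)%N = 0.
  have := lew_le le ag2; rewrite m2 /sg_alt /Defs.shift mulr0 sqrrN expr1n mul1r.
  by case: (bin01 (bt (k + 2)%N)) => ->.
have ag3 : agree 3 (shift k t) malt.
  case=> [|[|[|//]]] _; rewrite /Defs.shift.
  - by rewrite addn0 tk m0.
  - by rewrite t1 m1.
  - by rewrite t2 m2.
have t3 : t (k + 3)%N = 1.
  have := lew_le le ag3; rewrite m3 /Defs.shift sg_alt_odd //.
  by case: (bin01 (bt (k + 3)%N)) => ->.
exists 1, (shift 3 (shift k t)); split => //.
  by exists (k + 3)%N; rewrite ?shift_shift // /Defs.shift addn0.
by apply: wcatP => // -[|[|[|//]]] _; rewrite /Defs.shift ?addn0.
Qed.

(** Desubstitution shortens the common prefix with the fixed point, hence stops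
at the zero word. *)
Lemma M_alt_below n t : M_alt t -> ltw sg_alt n t malt -> exists m, t = iter m tau zerow.
Proof.
elim/ltn_ind: n t => n IH t Mt lt; have /M_altP[bt dt] := Mt.
have below k : lew sg_alt (shift k t) malt by apply: lew_trans (dt k) (ltw_lew lt).
case: (bin01 (bt 0%N)) => t0.
  exists 0%N; apply/funext => k; have := lew_le (dt k) (n := 0).
  rewrite /sg_alt expr0 !mul1r /Defs.shift addn0 t0 => h.
  have {h} : t k <= 0 by apply: h => ?; rewrite ltn0.
  by case: (bin01 (bt k)) => ->.
have [u bu tE] := desubst_tau bt t0 (fun k _ => below k).
have Mu : M_alt u by apply: M_alt_tau => //; rewrite -tE.
case: (lew_total sg_altP u malt) => [[um|[j uj]]|[j mu]].
- by move: lt; rewrite tE um tau_malt => /ltw_irr.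
- have jn : (j < n)%N.
    rewrite ltnNge; apply/negP => nj.
    have := tau_agree uj.1; rewrite -tE tau_malt => /(_ n) E.
    by move: lt.2; rewrite E // ltxx.
  by have [m um] := IH j jn u Mu uj; exists m.+1; rewrite tE um.
- have [m] := tau_mono words_malt bu mu; rewrite tau_malt -tE.
  by move/(lew_ltw_irr (ltw_lew lt)).
Qed.

Definition mabs : word := rho malt.

Lemma mabs_prefix : [/\ mabs 0%N = 1, mabs 1%N = 0 & mabs 2%N = -1].
Proof.
have [m0 _ _ _] := malt_prefix.
have E : mabs = wcat [:: 1; 0] (scalew (-1) (rho (shift 1 malt))).
  by rewrite /mabs rho_unfold m0.
by split; rewrite E /wcat //= /scalew rho_head.
Qed.

Lemma rho_lt_mabs n u : words bin u -> ltw sg_alt n u malt ->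
  exists m, ltw sg_lex m (rho u) mabs.
Proof. by move=> bu; apply: rho_mono => //; apply: words_malt. Qed.

Lemma zerow_lt_mabs : ltw sg_lex 0 zerow mabs.
Proof. by have [m0 _ _] := mabs_prefix; split => //; rewrite m0. Qed.

Lemma zerow_Mabs_lex : Mabs_lex zerow.
Proof. by apply/Mabs_lexP; split=> [n //|k e _]; left; rewrite -[RHS](scalew_zerow e). Qed.

(** The word rho(malt) starts with 1 0 -1, so a word at most rho(malt) that
starts with 1 starts with 1 -1 or with 1 0 -1. *)
Lemma desubst_rho s : words tern s -> s 0%N = 1 ->
  (forall k e, is_sign e -> lew sg_lex (scalew e (shift k s)) mabs) ->
  exists2 u, words bin u & s = rho u.
Proof.
move=> ts s0 below.
pose P w := w 0%N = 1 /\ exists k e, is_sign e /\ w = scalew e (shift k s).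
apply: (@desubstitution rho (fun x w => wcat (rho_block x) (scalew (-1) w)) P).
- exact: rho_unfold.
- move=> x n w w' ag; apply: agree_le (agree_wcat (agree_scalew _ ag)).
  by rewrite /rho_block; case: (_ == _) => /=; lia.
- move=> w [w0 [k [e [he wE]]]].
  have [m0 m1 m2] := mabs_prefix.
  have le : lew sg_lex w mabs by rewrite wE; apply: below.
  have tw : words tern w by rewrite wE; apply/words_scalew/words_shift.
  have peel l : w l = -1 -> P (scalew (-1) (shift l w)).
    move=> wl; split; first by rewrite /scalew /Defs.shift addn0 wl.
    exists (k + l)%N, (-1 * e); split; first by apply: is_signM => //; right.
    by rewrite wE shift_scalew shift_shift scalewA.
  have sN : is_sign (-1) by right.
  have ag1 : agree 1 w mabs by case=> // _; rewrite w0 m0.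
  have := lew_le le ag1; rewrite m1 !mul1r.
  case: (tern_cases (tw 1%N)) => [w1 _|w1 _|-> //].
    exists 0, (scalew (-1) (shift 1 w)); split => //; first exact: peel.
    by rewrite scalewK //; apply: wcatP => // -[|//] _.
  have ag2 : agree 2 w mabs by case=> [|[|//]] _; rewrite ?w0 ?m0 // w1 m1.
  have := lew_le le ag2; rewrite m2 !mul1r.
  case: (tern_cases (tw 2%N)) => [w2 _|-> //|-> //].
  exists 1, (scalew (-1) (shift 2 w)); split => //; first exact: peel.
  by rewrite scalewK //; apply: wcatP => // -[|[|//]] _.
- by split=> //; exists 0%N, 1; split; [left|rewrite scalew1 shift0].
Qed.

Lemma Mabs_lex_below n s : Mabs_lex s -> ltw sg_lex n s mabs ->
  s = zerow \/ exists m, s = rho (iter m tau zerow).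
Proof.
move=> Ms lt; have /Mabs_lexP[ts ds] := Ms.
have head k e : is_sign e -> e * s k <= s 0%N.
  move=> he; have := lew_le (@ds k e he) (n := 0).
  by rewrite !mul1r /scalew /Defs.shift addn0; apply => ?; rewrite ltn0.
have h1 : is_sign 1 by left.
have hN : is_sign (-1) by right.
case: (tern_cases (ts 0%N)) => s0.
- by have := head 0%N (-1) hN; rewrite s0.
- left; apply/funext => k; have := head k 1 h1; have := head k (-1) hN.
  by rewrite s0 /zerow; case: (tern_cases (ts k)) => ->.
right; have [|u bu sE] := desubst_rho ts s0.
  by move=> k e he; apply: lew_trans (@ds k e he) (ltw_lew lt).
have Mu : M_alt u by apply: M_alt_rho => //; rewrite -sE.
case: (lew_total sg_altP u malt) => [[um|[j uj]]|[j mu]].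
- by move: lt; rewrite sE um => /ltw_irr.
- by have [m um] := M_alt_below Mu uj; exists m; rewrite sE um.
- have [m] := rho_mono words_malt bu mu; rewrite -sE.
  by move/(lew_ltw_irr (ltw_lew lt)).
Qed.

(** * Accumulation points *)

Section word_accumulation.
Variable R : realType.

Lemma exprVn_anti (i j : nat) : (i <= j)%N -> (2 : R) ^- j <= 2 ^- i.
Proof.
move=> ij; rewrite lef_pV2 ?posrE ?exprn_gt0 //.
by rewrite ler_eXn2l // ltr1n.
Qed.

Lemma word_dist_agree k a b : agree k a b -> word_dist R a b < 2 ^- k.
Proof.
move=> ab; rewrite /word_dist; case: pselect => [ex|_]; last first.
  by rewrite invr_gt0 exprn_gt0.
case: ex_minnP => i /eqP nab _.
have ki : (k <= i)%N by rewrite leqNgt; apply/negP => ik; apply/nab/ab.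
apply: le_lt_trans (exprVn_anti (i := k.+1) _) _ => //.
rewrite ltf_pV2 ?posrE ?exprn_gt0 // ltr_eXn2l //; exact: ltr1n.
Qed.

Lemma agree_word_dist k a b : word_dist R a b < 2 ^- k -> agree k a b.
Proof.
rewrite /word_dist; case: pselect => [ex|nex] lt i ik; last first.
  by apply/eqP/negPn/negP => h; apply: nex; exists i.
apply/eqP/negPn/negP => nab; move: lt; case: ex_minnP => j _ min.
by rewrite ltNge exprVn_anti //; apply: leq_trans ik; rewrite ltnS; apply: min.
Qed.

Lemma separate_words (t : word) (r : nat -> word) N :
  exists K, forall i, (i < N)%N -> r i <> t -> ~ agree K t (r i).
Proof.
elim: N => [|N [K IH]]; first by exists 0%N.
have [E|/agree_first[n _ nr]] := pselect (r N = t).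
  exists K => i; rewrite ltnS leq_eqVlt => /orP[/eqP ->|]; last exact: IH.
  by [].
exists (maxn K n.+1) => i; rewrite ltnS leq_eqVlt => /orP[/eqP -> _ ag|iN ri ag].
  by apply: nr; rewrite ag // leq_maxr.
by apply: (IH i iN ri); apply: agree_le ag; apply: leq_maxl.
Qed.

(** A point t below m has a neighbourhood of words below m, where only the r n
occur; these tend to m and not to t. *)
Lemma smallest_word_accumulation sg (sgP : forall n, is_sign (sg n)) A
    (M : set word) (m : word) (r : nat -> word) :
  words A m -> (forall n, M (r n)) -> (forall n, r n <> m) ->
  (forall n, agree n (r n.+1) m) ->
  (forall b n, M b -> ltw sg n b m -> exists n, b = r n) ->
  is_smallest (lew sg) (word_accumulation R A M) m.
Proof.
move=> Am Mr rm cvg below; split.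
  split => // e e0.
  have q12 : `|2^-1 : R| < 1 by rewrite gtr0_norm; lra.
  have /cvgrPdist_lt/(_ e e0)[n _ /(_ n (leqnn _))] := cvg_geometric (1 : R) q12.
  rewrite /= sub0r normrN mul1r exprVn ger0_norm ?invr_ge0 ?exprn_ge0 // => lt.
  exists (r n.+1); split => //.
  by apply: lt_trans lt; apply: word_dist_agree; apply: agree_sym.
move=> t [At acc]; case: (lew_total sgP m t) => // -[j tm].
have [K sep] := separate_words t r j.+2.
have e0 : 0 < 2 ^- (maxn K j.+1) :> R by rewrite invr_gt0 exprn_gt0.
have [b [Mb bt /agree_word_dist ag]] := acc _ e0.
have [n bE] := below b j Mb (ltw_agreel (agree_le (leq_maxr _ _) ag) tm).
exfalso; case: (ltnP n j.+2) => nj.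
  apply: (sep n nj); rewrite -bE //.
  exact: agree_le (leq_maxl _ _) ag.
move: tm.2; case: n bE nj => // n bE nj.
rewrite (ag j) ?leq_maxr // bE (cvg n j) ?ltxx //.
Qed.

Lemma separate_reals (t : R) (f : nat -> R) N :
  exists2 d, 0 < d & forall i, (i < N)%N -> f i != t -> d <= `|t - f i|.
Proof.
elim: N => [|N [d d0 IH]]; first by exists 1.
have [E|nE] := eqVneq (f N) t.
  exists d => // i; rewrite ltnS leq_eqVlt => /orP[/eqP ->|]; last exact: IH.
  by rewrite E eqxx.
exists (Num.min d `|t - f N|).
  by rewrite lt_min d0 normr_gt0 subr_eq0 eq_sym.
move=> i; rewrite ltnS leq_eqVlt => /orP[/eqP -> _|iN fi].
  by rewrite ge_min lexx orbT.
by rewrite ge_min IH.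
Qed.

Lemma smallest_limit_point (L : set R) (m : R) (f : nat -> R) :
  (forall n, L (f n)) -> (forall n, f n != m) ->
  (forall e, 0 < e -> exists N, forall n, (N <= n)%N -> `|f n - m| < e) ->
  (forall y, L y -> y < m -> exists n, y = f n) ->
  is_smallest (fun x y : R => x <= y) (limit_point L) m.
Proof.
move=> Lf fm cvg below; split.
  move=> U /nbhs_ballP[e /= e0 eU]; have [N hN] := cvg e e0.
  exists (f N); split => //; apply: eU.
  by rewrite -ball_normE /= distrC hN.
move=> t lt; rewrite leNgt; apply/negP => tm.
have e0 : 0 < (m - t) / 2 by rewrite divr_gt0 // subr_gt0.
have [N hN] := cvg _ e0; have [d d0 sep] := separate_reals t f N.
have c0 : 0 < Num.min d ((m - t) / 2) by rewrite lt_min d0.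
have [y [yt Ly]] := lt _ (nbhsx_ballx t _ c0).
rewrite -ball_normE /= lt_min => /andP[yd ye].
have ym : y < m by have := ler_norm (y - t); rewrite distrC; lra.
have [n yE] := below y Ly ym; subst y.
case: (ltnP n N) => nN; first by have := sep n nN yt; lra.
have := hN n nN; have := ler_norm (f n - t); rewrite (distrC (f n) t).
by have := ler_norm (m - f n); rewrite (distrC m); lra.
Qed.

End word_accumulation.

(** With index 0 for the zero word, so that the values below the accumulation
point form a single sequence. *)
Definition mabs_approx (n : nat) : word :=
  if n is n'.+1 then rho (iter n' tau zerow) else zerow.

Lemma mabs_approx_Mabs n : Mabs_lex (mabs_approx n).
Proof. by case: n => [|n]; [exact: zerow_Mabs_lex|exact/rho_Mabs_lex/iter_tau_M_alt]. Qed.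

Lemma mabs_approx_lt n : exists m, ltw sg_lex m (mabs_approx n) mabs.
Proof.
case: n => [|n]; first by exists 0%N; apply: zerow_lt_mabs.
have [m h] := iter_tau_lt_malt n; exact: rho_lt_mabs (words_iter_tau n) h.
Qed.

Lemma mabs_approx_agree n : agree n (mabs_approx n.+1) mabs.
Proof. by apply: rho_agree; apply/agree_sym/malt_agree. Qed.

Lemma smallest_accumulation_mabs (R : realType) :
  is_smallest le_lex (word_accumulation R tern Mabs_lex) mabs.
Proof.
have -> : le_lex = lew sg_lex.
  by apply/funext => a; apply/funext => b; apply/propext/le_lexE.
apply: (@smallest_word_accumulation R _ sg_lexP _ _ _ mabs_approx).
- exact: words_rho.
- exact: mabs_approx_Mabs.
- by move=> n E; have [m] := mabs_approx_lt n; rewrite E => /ltw_irr.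
- exact: mabs_approx_agree.
- move=> b n Mb lt; have [->|[m ->]] := Mabs_lex_below Mb lt; first by exists 0%N.
  by exists m.+1.
Qed.

Lemma smallest_accumulation_malt (R : realType) :
  is_smallest le_alt (word_accumulation R bin M_alt) malt.
Proof.
have -> : le_alt = lew sg_alt.
  by apply/funext => a; apply/funext => b; apply/propext/le_altE.
apply: (@smallest_word_accumulation R _ sg_altP _ _ _ (fun n => iter n tau zerow)).
- exact: words_malt.
- exact: iter_tau_M_alt.
- by move=> n E; have [m] := iter_tau_lt_malt n; rewrite E => /ltw_irr.
- by move=> n; apply/agree_sym/malt_agree/leqnSn.
- by move=> b n Mb lt; apply: M_alt_below lt.
Qed.

(** * Values below the smallest accumulation point *)

Section below.
Variables (R : realType) (q : nat).
Hypothesis q2 : (2 <= q)%N.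
Local Notation Q := (q%:R : R).
Local Notation val := (pi_base Q).

Let Q2 : 2 <= Q := base_ge2 R q2.
Let Q0 : 0 < Q := base_gt0 R q2.
Let Qi0 : 0 < Q^-1.
Proof. by rewrite invr_gt0. Qed.
Let Qi2 : Q^-1 <= 1 / 2.
Proof. by rewrite mul1r lef_pV2 // posrE. Qed.

Lemma val_rho0 t : t 0%N = 0 -> val (rho t) = (1 - val (rho (shift 1 t))) / Q.
Proof.
move=> t0; rewrite (val_rec R q2 (words_rho t)) rho_head.
have -> : shift 1 (rho t) = scalew (-1) (rho (shift 1 t)).
  by rewrite [rho t]rho_unfold t0 (shift_wcat [:: 1]).
by rewrite (val_scalew R q2 (or_intror erefl) (words_rho _)) rmorphN1 mulN1r.
Qed.

Lemma val_rho1 t : t 0%N = 1 ->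
  val (rho t) = (1 - val (rho (shift 1 t)) / Q) / Q.
Proof.
move=> t0; rewrite (val_rec R q2 (words_rho t)) rho_head.
rewrite (val_shift_rec R q2 1 (words_rho t)).
have -> : shift 2 (rho t) = scalew (-1) (rho (shift 1 t)).
  by rewrite [rho t]rho_unfold t0 (shift_wcat [:: 1; 0]).
rewrite (val_scalew R q2 (or_intror erefl) (words_rho _)) rmorphN1 mulN1r.
by rewrite [rho t]rho_unfold t0 /wcat /= add0r mulNr.
Qed.

(** Each bound follows from the previous ones for the tail of t: first |v| <= 1,
then v >= 0, v <= 1/q, v > 0 and v < 1/q. *)
Lemma val_rho_bounds t : words bin t -> Q^-1 / 2 < val (rho t) < Q^-1.
Proof.
have i0 := Qi0; have i2 := Qi2.
have up (p : R) : p <= 1 -> p / Q <= 1 / 2.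
  by move=> p1; apply: le_trans Qi2; rewrite ler_piMl // ltW.
have lo (p : R) : 0 < p -> 0 < p / Q by move=> p0; apply: mulr_gt0.
have h1 u : words bin u -> 0 <= val (rho u).
  move=> bu; have := val_le1 R q2 (words_rho (shift 1 u)).
  rewrite ler_norml => /andP[_ p1]; have := up _ p1.
  by case: (bin01 (bu 0%N)) => [/val_rho0|/val_rho1] -> h; apply: mulr_ge0; lra.
have h2 u : words bin u -> val (rho u) <= Q^-1.
  move=> bu; have p0 := h1 _ (words_shift 1 bu); have := mulr_ge0 p0 (ltW Qi0).
  by case: (bin01 (bu 0%N)) => [/val_rho0|/val_rho1] -> h; apply: ler_piMl; lra.
have h3 u : words bin u -> 0 < val (rho u).
  move=> bu; have p1 := h2 _ (words_shift 1 bu).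
  have {}p1 : val (rho (shift 1 u)) <= 1 / 2 by lra.
  have := up _ (le_trans p1 (_ : 1 / 2 <= 1)).
  by case: (bin01 (bu 0%N)) => [/val_rho0|/val_rho1] -> h; apply: mulr_gt0; lra.
have h4 u : words bin u -> val (rho u) < Q^-1.
  move=> bu; have p0 := h3 _ (words_shift 1 bu); have := lo _ p0.
  by case: (bin01 (bu 0%N)) => [/val_rho0|/val_rho1] -> h; rewrite gtr_pMl //; lra.
move=> bt; rewrite h4 // andbT mulrC.
have p1 := h4 _ (words_shift 1 bt).
have p2 : val (rho (shift 1 t)) / Q < 1 / 2.
  by apply: lt_le_trans Qi2; rewrite gtr_pMl //; lra.
by case: (bin01 (bt 0%N)) => [/val_rho0|/val_rho1] ->; rewrite ltr_pM2r //; lra.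
Qed.

(** The bounds make the leading term of the comparison dominate, so that no two
distinct words have the same value, even in base 2. *)
Lemma val_rho_mono n u v : words bin u -> words bin v -> ltw sg_alt n u v ->
  val (rho u) < val (rho v).
Proof.
elim: n u v => [|n IH] u v bu bv uv.
  have [u0 v0] := ltw_alt_head bu bv uv.
  rewrite (val_rho0 u0) (val_rho1 v0) ltr_pM2r // ltrD2l ltrN2.
  have /andP[lo _] := val_rho_bounds (words_shift 1 bu).
  have /andP[lov hiv] := val_rho_bounds (words_shift 1 bv).
  have := Qi0; have := Qi2 => i2 i0.
  have p0 : 0 <= val (rho (shift 1 v)) by lra.
  by have := ler_wpM2l p0 i2; lra.
have := IH _ _ (words_shift 1 bv) (words_shift 1 bu) (ltw_alt_tail uv).
have uv0 : u 0%N = v 0%N by apply: uv.1.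
case: (bin01 (bv 0%N)) => v0; have u0 := v0; rewrite -uv0 in u0.
  by rewrite (val_rho0 u0) (val_rho0 v0) ltr_pM2r // ltrD2l ltrN2.
by rewrite (val_rho1 u0) (val_rho1 v0) ltr_pM2r // ltrD2l ltrN2 ltr_pM2r.
Qed.

Lemma val_rho_tail_half k t : words bin t -> `|val (shift k (rho t))| <= 1 / 2.
Proof.
move=> bt; have [[j [e [he ->]]]|z] := shift_rho k t.
  rewrite norm_val_scalew //; last exact: words_rho.
  have /andP[lo hi] := val_rho_bounds (words_shift j bt).
  by have := Qi0; have := Qi2 => i2 i0; rewrite ger0_norm; lra.
rewrite (val_shift_rec R q2 k (words_rho t)) z add0r normrM (gtr0_norm Qi0).
apply: le_trans Qi2; apply: ler_piMl; first exact: ltW.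
exact (val_le1 R q2 (words_shift k.+1 (words_rho t))).
Qed.

Lemma val_mabs_lt : val mabs < Q^-1.
Proof. by have /andP[] := val_rho_bounds words_malt. Qed.

Lemma val_mabs_half : val mabs < 1 / 2.
Proof. exact: lt_le_trans val_mabs_lt Qi2. Qed.

Lemma val_approx_lt n : val (mabs_approx n) < val mabs.
Proof.
case: n => [|n] /=.
  rewrite val_zerow //; have /andP[lo _] := val_rho_bounds words_malt.
  by apply: lt_trans lo; rewrite divr_gt0.
have [m h] := iter_tau_lt_malt n.
exact: val_rho_mono (words_iter_tau n) words_malt h.
Qed.

Lemma val_approx_ge0 n : 0 <= val (mabs_approx n).
Proof.
case: n => [|n] /=; first by rewrite val_zerow.
have /andP[lo _] := val_rho_bounds (words_iter_tau n).
by apply/ltW/lt_trans/lo; rewrite divr_gt0.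
Qed.

Lemma val_approx_cvg e : 0 < e ->
  exists N, forall n, (N <= n)%N -> `|val (mabs_approx n) - val mabs| < e.
Proof.
move=> e0; have [N hN] := small_power q2 2 e0; exists N.+1 => -[//|n] Nn.
apply: le_lt_trans (hN n Nn); apply: val_agree => //; try exact: words_rho.
exact: mabs_approx_agree.
Qed.

Lemma Mabs_val_ge0 s : Mabs_lex s -> val s <= 1 / 2 -> 0 <= val s.
Proof.
move=> Ms vs; have /Mabs_lexP[ts ds] := Ms.
exact: le_trans (normr_ge0 _) (Mabs_lex_val_le q2 Ms vs ts ds).
Qed.

(** Monotonicity of the value turns a comparison with the value of [mabs] into
a comparison of words. *)
Lemma Mabs_val_below s : Mabs_lex s -> val s < val mabs -> exists n, s = mabs_approx n.
Proof.
move=> Ms lt; have /Mabs_lexP[ts ds] := Ms.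
have vs : val s <= 1 / 2 by have := val_mabs_half; lra.
case: (lew_total sg_lexP mabs s) => [le|[n sm]]; last first.
  by have [->|[m ->]] := Mabs_lex_below Ms sm; [exists 0%N|exists m.+1].
suff : val mabs <= val s by rewrite leNgt lt.
apply: (val_mono_le q2 (words_rho malt) ts le) => k.
  exact: val_rho_tail_half words_malt.
apply: le_trans (Mabs_lex_val_le q2 Ms vs _ _) vs; first exact: words_shift.
exact: tails_dominated_shift.
Qed.

(** The cases q <= 3 and q >= 4 both apply since the value of [mabs] is less than
1/q <= 1/(q - 1). *)
Lemma Ltilde_below y : Ltilde Q y -> y < val mabs -> exists2 s, Mabs_lex s & val s = y.
Proof.
move=> Ly ym; case: (leqP q 3) => q3.
  by have [s Ms [vs _]] := Ltilde_le3 q2 q3 Ly; exists s.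
apply: (Ltilde_ge4 q2 q3 Ly); apply: ltW; apply: (lt_trans ym).
apply: lt_le_trans val_mabs_lt _.
by have := Q2 => h; rewrite mul1r lef_pV2 ?posrE; lra.
Qed.

Lemma Ltilde_approx n : Ltilde Q (val (mabs_approx n)).
Proof.
apply: (Mabs_lex_Ltilde q2 (mabs_approx_Mabs n)).
by have := val_approx_lt n; have := val_mabs_half; lra.
Qed.

Lemma smallest_limit_point_Ltilde :
  is_smallest (fun x y : R => x <= y) (limit_point (Ltilde Q)) (val mabs).
Proof.
apply: (@smallest_limit_point R _ _ (fun n => val (mabs_approx n))).
- exact: Ltilde_approx.
- by move=> n; rewrite lt_eqF // val_approx_lt.
- exact: val_approx_cvg.
- move=> y Ly ym; have [s Ms vs] := Ltilde_below Ly ym; rewrite -vs in ym *.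
  by have [n ->] := Mabs_val_below Ms ym; exists n.
Qed.

Lemma Ltilde_Mabs_below :
  Ltilde Q `&` `[0, val mabs[ = (val @` Mabs_lex) `&` `[0, val mabs[.
Proof.
apply/seteqP; split=> y [Ly]; rewrite /= in_itv /= => /andP[y0 ym].
  have [s Ms vs] := Ltilde_below Ly ym.
  by split; [exists s|rewrite /= ?in_itv /= y0 ym].
have [s Ms vs] := Ly; split; last by rewrite /= ?in_itv /= y0 ym.
rewrite -vs; apply: Mabs_lex_Ltilde => //.
by rewrite vs; have := val_mabs_half; lra.
Qed.

Lemma Mabs_below_values :
  (val @` Mabs_lex) `&` `[0, val mabs[ = [set 0] `|`
    range (fun n : nat => val (extend rho2 (extend (iter n tau02) zerow))).
Proof.
have E n : val (extend rho2 (extend (iter n tau02) zerow)) = val (mabs_approx n.+1).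
  by rewrite extend_iter_tau02.
have approx n : ((val @` Mabs_lex) `&` `[0, val mabs[) (val (mabs_approx n)).
  split; first by exists (mabs_approx n) => //; apply: mabs_approx_Mabs.
  by rewrite /= in_itv /= val_approx_ge0 val_approx_lt.
apply/seteqP; split=> y.
  move=> [[s Ms <-]]; rewrite /= in_itv /= => /andP[_ sm].
  have [[|n] ->] := Mabs_val_below Ms sm; first by left; rewrite val_zerow.
  by right; exists n; rewrite // E.
move=> [->|[n _ <-]]; last by rewrite E.
by have := approx 0%N; rewrite /= val_zerow.
Qed.

End below.

Lemma Ltilde_base2_half (R : realType) :
  Ltilde (2 : R) = (pi_base (2 : R) @` Mabs_lex) `&` `[0, 1 / 2].
Proof.
apply/seteqP; split=> y.
  move=> Ly; have [s Ms [vs y2]] := @Ltilde_le3 R 2 isT y isT Ly.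
  split; first by exists s.
  by rewrite /= in_itv /= (Ltilde_ge0 Ly).
move=> [[s Ms <-]]; rewrite /= in_itv /= => /andP[_ v2].
exact: (@Mabs_lex_Ltilde R 2 isT).
Qed.

(** The word 1 1 1 ... has value 1 in base 2. *)
Lemma Mabs_base2_not_half (R : realType) :
  (pi_base (2 : R) @` Mabs_lex) `&` `[0, 1 / 2] <> pi_base (2 : R) @` Mabs_lex.
Proof.
pose one : word := fun _ => 1.
have t1 : words tern one by [].
have M1 : Mabs_lex one.
  apply/Mabs_lexP; split => // k e [->|->]; first by left.
  by apply: (@ltw_lew _ 0); split.
have v1 : pi_base (2 : R) one = 1.
  have := @val_rec R 2 isT _ t1; rewrite (_ : shift 1 one = one) //.
  by rewrite /one /=; lra.
move=> E; have : (pi_base (2 : R) @` Mabs_lex) 1 by exists one.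
by rewrite -E => -[_]; rewrite /= in_itv /= => /andP[_]; lra.
Qed.

Lemma Ltilde_base3 (R : realType) : Ltilde (3 : R) = pi_base (3 : R) @` Mabs_lex.
Proof.
apply/seteqP; split=> y.
  by move=> Ly; have [s Ms [vs y2]] := @Ltilde_le3 R 3 isT y isT Ly; exists s.
move=> [s Ms <-]; apply: (@Mabs_lex_Ltilde R 3 isT) => //.
apply: le_trans (ler_norm _) _; apply: (@val_tern_le_half R 3 isT) => //.
by have /Mabs_lexP[] := Ms.
Qed.

Lemma Mabs_Ltilde_ge4 (R : realType) (q : nat) : (4 <= q)%N ->
  pi_base (q%:R : R) @` Mabs_lex = Ltilde (q%:R : R) `&` `[0, 1 / (q%:R - 1)].
Proof.
move=> q4; have q2 : (2 <= q)%N by lia.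
apply/seteqP; split=> y.
  move=> [s Ms <-]; have /Mabs_lexP[ts _] := Ms.
  have vs : pi_base (q%:R : R) s <= 1 / 2.
    by apply: le_trans (ler_norm _) _; apply: val_tern_le_half => //; lia.
  split; first exact: Mabs_lex_Ltilde.
  rewrite /= in_itv /= Mabs_val_ge0 //=.
  exact: le_trans (ler_norm _) (val_bound _ _ _).
move=> [Ly]; rewrite /= in_itv /= => /andP[_ yle].
by have [s Ms vs] := Ltilde_ge4 q2 q4 Ly yle; exists s.
Qed.

Lemma Ltilde_ge4_not_bounded (R : realType) (q : nat) : (4 <= q)%N ->
  Ltilde (q%:R : R) `&` `[0, 1 / (q%:R - 1)] <> Ltilde (q%:R : R).
Proof.
move=> q4 E; have q2 : (2 <= q)%N by lia.
have := Ltilde_two_div R q4; rewrite -E => -[_]; rewrite /= in_itv /= => /andP[_].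
have Q4 : 4 <= q%:R :> R by rewrite ler_nat.
rewrite ler_pdivrMr; last by lra.
by rewrite mulrAC mul1r ler_pdivlMr; lra.
Qed.

Theorem proposition10 (R : realType) :
  [/\ Ltilde (2 : R) = (pi_base (2 : R) @` Mabs_lex) `&` `[0, 1 / 2] /\
      (pi_base (2 : R) @` Mabs_lex) `&` `[0, 1 / 2]
        <> pi_base (2 : R) @` Mabs_lex,
      Ltilde (3 : R) = pi_base (3 : R) @` Mabs_lex,
      (forall q : nat, (4 <= q)%N ->
        pi_base (q%:R : R) @` Mabs_lex
          = Ltilde (q%:R : R) `&` `[0, 1 / (q%:R - 1)] /\
        Ltilde (q%:R : R) `&` `[0, 1 / (q%:R - 1)] <> Ltilde (q%:R : R)) &
      exists mabs malt : word,
        [/\ is_smallest le_lex (word_accumulation R tern Mabs_lex) mabs,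
            is_smallest le_alt (word_accumulation R bin M_alt) malt &
            forall q : nat, (2 <= q)%N ->
              exists mq : R,
                [/\ is_smallest (fun x y : R => x <= y)
                      (limit_point (Ltilde (q%:R : R))) mq,
                    mq = pi_base (q%:R : R) mabs,
                    pi_base (q%:R : R) mabs = pi_base (q%:R : R) (extend rho2 malt),
                    Ltilde (q%:R : R) `&` `[0, mq[
                      = (pi_base (q%:R : R) @` Mabs_lex) `&` `[0, mq[ &
                    (pi_base (q%:R : R) @` Mabs_lex) `&` `[0, mq[
                      = [set 0] `|`
                        range (fun n : nat =>
                          pi_base (q%:R : R)
                            (extend rho2
                               (extend (iter n tau02) zerow)))]]].
Proof.
split.
- by split; [exact: Ltilde_base2_half|exact: Mabs_base2_not_half].
- exact: Ltilde_base3.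
- by move=> q q4; split; [exact: Mabs_Ltilde_ge4|exact: Ltilde_ge4_not_bounded].
exists mabs, malt; split.
- exact: smallest_accumulation_mabs.
- exact: smallest_accumulation_malt.
move=> q q2; exists (pi_base (q%:R : R) mabs); split => //.
- exact: smallest_limit_point_Ltilde.
- exact: Ltilde_Mabs_below.
- exact: Mabs_below_values.
Qed.
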